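(* Let $(\Omega,\mathcal A)$ be a measurable space, let $U\subset\mathbb C^n$ be an open set such that $\lambda z\in U$ whenever $z\in U$ and $\lambda\in\mathbb C$, $|\lambda|\le1$, and let $f(\omega,z)$ be a random holomorphic function in $U$. Then there is a sequence $p_m(\omega,z)$, $m=0,1,\ldots$, of random polynomials such that, for every $\omega\in\Omega$, $p_m(\omega,\cdot)$ converges to $f(\omega,\cdot)$ uniformly on every compact subset of $U$.
   Context: A random holomorphic function on an open set $U\subset\mathbb C^n$ is a function $f:\Omega\times U\to\mathbb C$ such that $f(\omega,\cdot)$ is holomorphic for each $\omega$ and $f(\cdot,z)$ is measurable for each $z\in U$. A random polynomial is a function $p(\omega,z)$ such that $p(\omega,\cdot)$ is a polynomial for each $\omega$ and $p(\cdot,z)$ is measurable for each $z$. *)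

(* Defs.v *)
From HB Require Import structures.
From mathcomp Require Import all_boot all_order all_algebra.
From mathcomp Require Import all_classical all_reals all_analysis.
From mathcomp Require Import complex.
Import Order.TTheory GRing.Theory Num.Theory numFieldNormedType.Exports
  numFieldTopology.Exports ComplexField.

Set Implicit Arguments.
Unset Strict Implicit.
Unset Printing Implicit Defensive.

Local Open Scope ring_scope.
Local Open Scope classical_set_scope.

(* The complex field R[i] is a numClosedFieldType; equip it (as the library
   does for R^o) with its canonical metric topology and with its structure of
   normed module over itself. C^n = 'rV[R[i]]_n then carries the product
   (max-norm) topology and is a normed R[i]-module. *)
HB.instance Definition _ (R : rcfType) :=
  PseudoPointedMetric.copy R[i] (R[i])^o.
HB.instance Definition _ (R : rcfType) :=
  NormedModule.copy R[i] (R[i])^o.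

(* Holomorphic on an open set U of C^n: complex (Frechet) differentiable at
   every point of U, the differential being taken over the scalar field R[i],
   hence C-linear. *)
Definition holomorphic_on (R : realType) (n : nat)
    (U : set 'rV[R[i]]_n) (g : 'rV[R[i]]_n -> R[i]) : Prop :=
  forall z, U z -> differentiable g z.

Definition polynomial_fun (R : realType) (n : nat)
    (g : 'rV[R[i]]_n -> R[i]) : Prop :=
  exists s : seq (R[i] * ('I_n -> nat)),
    forall z, g z = \sum_(c <- s) c.1 * \prod_(j < n) (z 0 j) ^+ (c.2 j).

(* Measurability of an omega |-> C map, C carrying its Borel sigma-algebra
   (= Borel(R) x Borel(R) via real and imaginary parts). *)
Definition measurable_C (d : measure_display) (T : measurableType d)
    (R : realType) (h : T -> R[i]) : Prop :=
  measurable_fun setT (fun w => complex.Re (h w)) /\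
  measurable_fun setT (fun w => complex.Im (h w)).

Definition random_holomorphic (d : measure_display) (T : measurableType d)
    (R : realType) (n : nat) (U : set 'rV[R[i]]_n)
    (f : T -> 'rV[R[i]]_n -> R[i]) : Prop :=
  (forall w, holomorphic_on U (f w)) /\
  (forall z, U z -> measurable_C (fun w => f w z)).

Definition random_polynomial (d : measure_display) (T : measurableType d)
    (R : realType) (n : nat) (p : T -> 'rV[R[i]]_n -> R[i]) : Prop :=
  (forall w, polynomial_fun (p w)) /\
  (forall z, measurable_C (fun w => p w z)).

Definition balanced (R : realType) (n : nat) (U : set 'rV[R[i]]_n) : Prop :=
  forall (z : 'rV[R[i]]_n) (l : R[i]), U z -> `|l| <= 1 -> U (l *: z).

Definition cvg_locally_uniformly (R : realType) (n : nat)
    (U : set 'rV[R[i]]_n) (g : nat -> 'rV[R[i]]_n -> R[i])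
    (h : 'rV[R[i]]_n -> R[i]) : Prop :=
  forall K : set 'rV[R[i]]_n, compact K -> K `<=` U ->
    forall e : R[i], 0 < e -> exists M : nat, forall m : nat, (M <= m)%N ->
      forall z, K z -> `|g m z - h z| < e.

(* Main.v *)
(* Let zeta_n be a primitive 2^n-th root of unity and avg n g the mean of g over
   the powers of zeta_n. Complex analysis enters only through discrete circle
   means: if h is complex differentiable on |rho| <= |z| <= 1, then
   avg n (h (rho .)) - avg n h tends to 0. This is Goursat's argument on the grid
   rho^(i/2^n) zeta_n^j: sums over the boundary of a cell vanish on affine
   functions and telescope, so a non-vanishing limit would survive bisection and
   contradict differentiability at the limit point. Letting rho tend to 0 gives
   the mean value property, hence Taylor coefficients coef g m as limits of
   avg n (g u^-m), the vanishing of those with m < 0, and (Fejer) the convergence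
   of the Cesaro means of sum_m coef g m to g 1 at an explicit rate.
   On the balanced set U the coefficients of u |-> f (u z) give the k-homogeneous
   part P_k of f, measurable in omega as a limit of finite means, and the Cesaro
   means of sum_k P_k converge to f uniformly on compact sets. Fejer's theorem in
   a second variable shows that P_k is a polynomial of degree at most k on lines;
   interpolating at roots of unity one coordinate at a time, it is a polynomial. *)
Require Import Defs.
From HB Require Import structures.
From mathcomp Require Import all_boot all_order all_algebra.
From mathcomp Require Import all_classical all_reals all_analysis.
From mathcomp Require Import complex.
From mathcomp Require Import ring lra zify measurable_realfun.
Import Order.TTheory GRing.Theory Num.Theory numFieldNormedType.Exports
  numFieldTopology.Exports ComplexField.
Import Normc.
Set Implicit Arguments.
Unset Strict Implicit.
Unset Printing Implicit Defensive.
Local Open Scope ring_scope.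
Local Open Scope classical_set_scope.

(** * The modulus and limits of complex sequences *)

Lemma exists_pow2_lt (R : realType) (C d : R) : 0 <= C -> 0 < d ->
  exists n, C / 2 ^+ n < d.
Proof.
move=> C0 d0; exists (Num.bound (C / d)); rewrite ltr_pdivrMr ?exprn_gt0 //.
rewrite mulrC -ltr_pdivrMr //; apply: lt_trans (archi_boundP _) _.
  by rewrite divr_ge0 // ltW.
by rewrite -natrX ltr_nat ltn_expl.
Qed.

Section Modulus.
Variable R : realType.
Implicit Types x y z : R[i].

Lemma normrC x : `|x| = (normc x)%:C%C.
Proof. by []. Qed.

Lemma normc_ge0 x : 0 <= normc x.
Proof. by rewrite -ler0c -normrC. Qed.

Lemma normc0E : normc (0 : R[i]) = 0.
Proof. exact: normc0. Qed.

Lemma normc1E : normc (1 : R[i]) = 1.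
Proof. exact: normc1. Qed.

Lemma normc_eq0 x : (normc x == 0) = (x == 0).
Proof. by apply/eqP/eqP => [/eq0_normc//|->]; exact: normc0. Qed.

Lemma normc_gt0 x : (0 < normc x) = (x != 0).
Proof. by rewrite lt_neqAle normc_ge0 andbT eq_sym normc_eq0. Qed.

Lemma ler_normcD x y : normc (x + y) <= normc x + normc y.
Proof. exact: le_normcD. Qed.

Lemma normcNE x : normc (- x) = normc x.
Proof. exact: normcN. Qed.

Lemma ler_normcB x y : normc (x - y) <= normc x + normc y.
Proof. by rewrite -[normc y]normcNE ler_normcD. Qed.

Lemma normcBC x y : normc (x - y) = normc (y - x).
Proof. by rewrite -normcNE opprB. Qed.

Lemma ler_normc_dist x y z : normc (x - z) <= normc (x - y) + normc (y - z).
Proof. by rewrite (le_trans _ (ler_normcD _ _)) // addrA subrK. Qed.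

Lemma ler_normc_sub x y : normc x - normc y <= normc (x - y).
Proof. by rewrite lerBlDr (le_trans _ (ler_normcD _ _)) // subrK. Qed.

Lemma normcX x n : normc (x ^+ n) = normc x ^+ n.
Proof.
by elim: n => [|n IH]; rewrite ?expr0 ?normc1E// !exprS normcM IH.
Qed.

Lemma normcXV x n : normc (x^-1 ^+ n) = (normc x)^-1 ^+ n.
Proof. by rewrite normcX normcV. Qed.

Lemma normcr (r : R) : normc r%:C%C = `|r|.
Proof. by rewrite /= expr0n addr0 sqrtr_sqr. Qed.

Lemma normc_nat n : normc (n%:R : R[i]) = n%:R.
Proof. by rewrite -[n%:R](rmorph_nat (real_complex R)) normcr normr_nat. Qed.

Lemma ler_normc_sum (I : Type) (r : seq I) (P : pred I) (F : I -> R[i]) :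
  normc (\sum_(i <- r | P i) F i) <= \sum_(i <- r | P i) normc (F i).
Proof.
elim/big_rec2: _ => [|i y x _ h]; first by rewrite normc0E.
by rewrite (le_trans (ler_normcD _ _)) // lerD2l.
Qed.

Lemma normc_sqr x : normc x ^+ 2 = complex.Re x ^+ 2 + complex.Im x ^+ 2.
Proof. by case: x => a b /=; rewrite sqr_sqrtr // addr_ge0 // sqr_ge0. Qed.

Lemma normc_Re x : `|complex.Re x| <= normc x.
Proof.
rewrite -(@ler_pXn2r _ 2) ?nnegrE ?normc_ge0 // normc_sqr real_normK ?num_real //.
by rewrite lerDl sqr_ge0.
Qed.

Lemma normc_Im x : `|complex.Im x| <= normc x.
Proof.
rewrite -(@ler_pXn2r _ 2) ?nnegrE ?normc_ge0 // normc_sqr real_normK ?num_real //.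
by rewrite lerDr sqr_ge0.
Qed.

Lemma normc_ReIm x : normc x <= `|complex.Re x| + `|complex.Im x|.
Proof.
rewrite -(@ler_pXn2r _ 2) ?nnegrE ?normc_ge0 ?addr_ge0 // normc_sqr.
rewrite sqrrD !real_normK ?num_real // lerD2r lerDl.
by rewrite mulrn_wge0 // mulr_ge0.
Qed.

Lemma ReB x y : complex.Re (x - y) = complex.Re x - complex.Re y.
Proof. by case: x y => [a b] [c d]. Qed.

Lemma ImB x y : complex.Im (x - y) = complex.Im x - complex.Im y.
Proof. by case: x y => [a b] [c d]. Qed.

Lemma cvgCP (a : nat -> R[i]) (l : R[i]) : a @ \oo --> l <->
  forall e : R, 0 < e -> exists N, forall n, (N <= n)%N -> normc (a n - l) < e.
Proof.
split=> [/cvgrPdist_lt h e e0|h].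
  have e0' : 0 < e%:C%C by rewrite ltcR.
  have [N _ hN] := h _ e0'; exists N => n Nn.
  by rewrite normcBC -ltcR -normrC; exact: (hN n Nn).
apply/cvgrPdist_lt => e e0.
have eR : e = (complex.Re e)%:C%C by rewrite RRe_real // gtr0_real.
have /h[N hN] : 0 < complex.Re e by rewrite -ltcR -eR.
exists N => // n /= Nn; rewrite eR normrC ltcR normcBC; exact: hN.
Qed.

Lemma cvgC_le (a : nat -> R[i]) (l b : R[i]) (B : R) N : a @ \oo --> l ->
  (forall n, (N <= n)%N -> normc (a n - b) <= B) -> normc (l - b) <= B.
Proof.
move=> /cvgCP al aB; apply/ler_addgt0Pl => e e0.
have [M hM] := al _ e0.
rewrite (le_trans (ler_normc_dist l (a (maxn N M)) b)) // lerD //.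
  by rewrite normcBC ltW // hM // leq_maxr.
by rewrite aB // leq_maxl.
Qed.

Lemma cvgC_Re (a : nat -> R[i]) (l : R[i]) : a @ \oo --> l ->
  (fun n => complex.Re (a n)) @ \oo --> complex.Re l.
Proof.
move=> /cvgCP h; apply/cvgrPdist_lt => e /h[N hN]; exists N => // n /= Nn.
by rewrite distrC -ReB (le_lt_trans (normc_Re _)) // hN.
Qed.

Lemma cvgC_Im (a : nat -> R[i]) (l : R[i]) : a @ \oo --> l ->
  (fun n => complex.Im (a n)) @ \oo --> complex.Im l.
Proof.
move=> /cvgCP h; apply/cvgrPdist_lt => e /h[N hN]; exists N => // n /= Nn.
by rewrite distrC -ImB (le_lt_trans (normc_Im _)) // hN.
Qed.

Lemma cvgR_cauchy (a : nat -> R) :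
  (forall e : R, 0 < e -> exists N, forall n, (N <= n)%N -> `|a n - a N| < e) ->
  cvgn a.
Proof.
move=> h; apply/cauchy_cvgP/cauchy_exP => e /h[N hN].
by exists (a N); exists N => // n /= Nn; rewrite /ball/= distrC hN.
Qed.

Lemma cvgC_cauchy (a : nat -> R[i]) :
  (forall e : R, 0 < e -> exists N, forall n, (N <= n)%N -> normc (a n - a N) < e) ->
  cvgn a.
Proof.
move=> h.
have /cvg_ex[/= x ax] : cvgn (fun n => complex.Re (a n)).
  apply: cvgR_cauchy => e /h[N hN]; exists N => n Nn.
  by rewrite -ReB (le_lt_trans (normc_Re _)) // hN.
have /cvg_ex[/= y ay] : cvgn (fun n => complex.Im (a n)).
  apply: cvgR_cauchy => e /h[N hN]; exists N => n Nn.
  by rewrite -ImB (le_lt_trans (normc_Im _)) // hN.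
apply/cvg_ex; exists (x +i* y)%C; apply/cvgCP => e e0.
have e20 : 0 < e / 2 by lra.
move/cvgrPdist_lt : ax => /(_ _ e20)[N1 _ h1].
move/cvgrPdist_lt : ay => /(_ _ e20)[N2 _ h2].
exists (maxn N1 N2) => n; rewrite geq_max => /andP[n1 n2].
rewrite (le_lt_trans (normc_ReIm _)) // ReB ImB /=.
have := h1 n n1; have := h2 n n2; rewrite /= distrC => hy; rewrite distrC => hx.
by rewrite (splitr e) ltrD.
Qed.

Lemma cvgC_sum (I : Type) (r : seq I) (F : I -> nat -> R[i]) (l : I -> R[i]) :
  (forall i, F i @ \oo --> l i) ->
  (fun n => \sum_(i <- r) F i n) @ \oo --> \sum_(i <- r) l i.
Proof.
move=> h; elim: r => [|i r IH].
  rewrite big_nil (_ : (fun _ => _) = fun=> 0); first exact: cvg_cst.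
  by apply/funext => n; rewrite big_nil.
rewrite big_cons (_ : (fun _ => _) = fun n => F i n + \sum_(j <- r) F j n).
  exact: (@cvgD _ R[i] nat \oo _ (F i) _ (l i) _ (h i) IH).
by apply/funext => n; rewrite big_cons.
Qed.

Lemma cvgCMl (a : nat -> R[i]) (l b : R[i]) : a @ \oo --> l ->
  (fun n => b * a n) @ \oo --> b * l.
Proof. by move=> al; exact: (@cvgM _ nat \oo _ (fun=> b) a b l (cvg_cst _) al). Qed.

End Modulus.

(** * Roots of unity of order 2^n *)

Section Roots.
Variable R : realType.
Implicit Types x y z : R[i].

(** Normalised to nonnegative real part, so that iterated square roots of a nonzero number approach
    1. *)
Definition csqrt x : R[i] :=
  if 0 <= complex.Re (sqrtc x) then sqrtc x else - sqrtc x.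

Lemma csqrtK x : csqrt x ^+ 2 = x.
Proof. by rewrite /csqrt; case: ifP => _; rewrite ?sqrrN sqr_sqrtc. Qed.

Lemma Re_csqrt x : 0 <= complex.Re (csqrt x).
Proof.
rewrite /csqrt; case: ifPn => //; rewrite -ltNge; case: (sqrtc x) => a b /=.
by rewrite oppr_ge0 => /ltW.
Qed.

Definition root2 x n : R[i] := iter n csqrt x.

(** The tower of square roots starts from -1, since [csqrt] would fix 1; [zeta n] thus has order
    exactly 2^n. *)
Definition zeta n : R[i] := if n is n'.+1 then root2 (-1) n' else 1.

Lemma root2_sqr x n : root2 x n.+1 ^+ 2 = root2 x n.
Proof. exact: csqrtK. Qed.

Lemma zeta_sqr n : zeta n.+1 ^+ 2 = zeta n.
Proof. by case: n => [|n]; [rewrite /= sqrrN expr1n|exact: csqrtK]. Qed.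

Lemma sqr_seqX (x : nat -> R[i]) : (forall n, x n.+1 ^+ 2 = x n) ->
  forall m p, x (m + p)%N ^+ (2 ^ p) = x m.
Proof.
move=> xS m; elim=> [|p IH]; first by rewrite addn0 expr1.
by rewrite addnS expnS exprM xS.
Qed.

Lemma root2X x n : root2 x n ^+ (2 ^ n) = x.
Proof. exact: (sqr_seqX (root2_sqr x) 0%N n). Qed.

Lemma zetaX n : zeta n ^+ (2 ^ n) = 1.
Proof. exact: (sqr_seqX zeta_sqr 0%N n). Qed.

Lemma zeta_half n : zeta n.+1 ^+ (2 ^ n) = -1.
Proof. by rewrite root2X. Qed.

Lemma normc_eq1 x n : (0 < n)%N -> x ^+ n = 1 -> normc x = 1.
Proof.
move=> n0 xn; apply/eqP; rewrite -(@pexpr_eq1 _ _ n) ?normc_ge0 //.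
by rewrite -normcX xn normc1E.
Qed.

Lemma normc_zeta n : normc (zeta n) = 1.
Proof. by apply: (@normc_eq1 _ (2 ^ n)); rewrite ?expn_gt0 // zetaX. Qed.

Lemma normc_zetaX n j : normc (zeta n ^+ j) = 1.
Proof. by rewrite normcX normc_zeta expr1n. Qed.

Lemma zeta_neq0 n : zeta n != 0.
Proof. by rewrite -normc_gt0 normc_zeta. Qed.

Lemma sqr_seq_norm (x : nat -> R[i]) : (forall n, x n.+1 ^+ 2 = x n) ->
  normc (x 0%N) <= 1 -> forall n, normc (x 0%N) <= normc (x n) <= 1.
Proof.
move=> xS x1; elim=> [|n /andP[IH1 IH2]]; first by rewrite lexx.
have E : normc (x n.+1) ^+ 2 = normc (x n) by rewrite -normcX xS.
have h : normc (x n.+1) <= 1.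
  by rewrite -(@expr_le1 _ 2) // ?normc_ge0 // E.
rewrite h andbT (le_trans IH1) // -E expr2.
by rewrite -[leRHS]mul1r ler_wpM2r ?normc_ge0.
Qed.

(** Write d_n = |x_n - 1|, so that d_n = d_(n+1) |x_(n+1) + 1|. A nonnegative real part forces
    |x_(n+1) + 1|^2 >= 1 + c^2, so d becomes small; once d is at most 1/2, the factor is close
    enough to 2 for 2^n d_n to stay bounded. *)
Lemma sqr_seq_bound (x : nat -> R[i]) N : (forall n, x n.+1 ^+ 2 = x n) ->
  x 0%N != 0 -> normc (x 0%N) <= 1 ->
  (forall n, (N <= n)%N -> 0 <= complex.Re (x n)) ->
  exists2 C : R, 0 <= C & forall n, 2 ^+ n * normc (x n - 1) <= C.
Proof.
move=> xS x0 x1 xRe; have [c cE c0] : exists2 c : R, c = normc (x 0%N) & 0 < c.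
  by exists (normc (x 0%N)); rewrite ?normc_gt0.
pose d n : R := normc (x n - 1).
have d0 n : 0 <= d n by exact: normc_ge0.
have dM n : d n = d n.+1 * normc (x n.+1 + 1).
  by rewrite /d -normcM -subr_sqr_1 xS.
have dS n : (N <= n)%N -> (1 + c ^+ 2) * d n.+1 ^+ 2 <= d n ^+ 2.
  move=> Nn; rewrite (dM n) exprMn mulrC ler_wpM2l ?sqr_ge0 //.
  have /andP[+ _] := sqr_seq_norm xS x1 n.+1.
  rewrite -cE => cx; have : c ^+ 2 <= normc (x n.+1) ^+ 2.
    by rewrite ler_pXn2r ?nnegrE ?normc_ge0 ?(ltW c0).
  rewrite 2!normc_sqr; have := xRe n.+1 (leqW Nn).
  by case: (x n.+1) => a b /=; rewrite addr0; nra.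
have dle n : (N <= n)%N -> d n.+1 <= d n.
  move=> Nn; rewrite -(@ler_pXn2r _ 2) ?nnegrE //.
  by apply: le_trans (dS _ Nn); have := sqr_ge0 (d n.+1); have := sqr_ge0 c; nra.
(* Bernoulli's weakening of the geometric decay; a factor growing linearly already brings [d] below
   1/2. *)
have dgeo n : (1 + n%:R * c ^+ 2) * d (N + n)%N ^+ 2 <= d N ^+ 2.
  elim: n => [|n IH]; first by rewrite mul0r addr0 mul1r addn0.
  apply: le_trans IH; rewrite addnS.
  have := dS (N + n)%N (leq_addr _ _).
  have n0 : 0 <= n%:R :> R by [].
  have n1 : n.+1%:R = n%:R + 1 :> R by rewrite -natr1.
  rewrite n1; have c20 := sqr_ge0 c; have q0 := sqr_ge0 (d (N + n).+1).
  move=> h; have : (1 + n%:R * c ^+ 2) * ((1 + c ^+ 2) * d (N + n).+1 ^+ 2)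
    <= (1 + n%:R * c ^+ 2) * d (N + n)%N ^+ 2.
    by rewrite ler_wpM2l // addr_ge0 // mulr_ge0.
  apply: le_trans; rewrite mulrA ler_wpM2r //.
  have : 0 <= n%:R * (c ^+ 2 * c ^+ 2) by rewrite mulr_ge0 // mulr_ge0.
  by nra.
have [n1 hn1] : exists n1, d (N + n1)%N <= 1 / 2.
  pose n1 := Num.bound (4 * d N ^+ 2 / c ^+ 2).
  have hn : 4 * d N ^+ 2 / c ^+ 2 < n1%:R.
    by apply: archi_boundP; rewrite divr_ge0 ?mulr_ge0 ?sqr_ge0 // ltW.
  exists n1; rewrite -(@ler_pXn2r _ 2) ?nnegrE //.
  have := dgeo n1; move: hn; rewrite ltr_pdivrMr ?exprn_gt0 //.
  have := sqr_ge0 (d (N + n1)%N); have := exprn_gt0 2 c0.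
  set u := d (N + n1)%N ^+ 2; set v := c ^+ 2; set m : R := n1%:R; move=> v0 u0 h1 h2.
  rewrite expr_div_n expr1n leNgt; apply/negP => h3.
  have : m * v * (1 / 2 ^+ 2) <= m * v * u.
    apply: ler_wpM2l; first by rewrite mulr_ge0 // ltW.
    by apply: ltW.
  by nra.
set n0 := (N + n1)%N in hn1.
have dhalf p : d (n0 + p)%N <= 1 / 2.
  elim: p => [|p IH]; first by rewrite addn0.
  by rewrite addnS (le_trans _ IH) // dle // /n0 -addnA leq_addr.
(* The correction 1 + 4d absorbs the gap between |x + 1| >= 2 - d and 2. With v the next distance,
   v(2-v)(1 + 4v(2-v)) - 2v(1 + 4v) = v^2 (1/2 - v)(14 - 4v) >= 0, so [E] does not increase from
   [n0] on. *)
pose E n := 2 ^+ n * (d n * (1 + 4 * d n)).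
have Ele p : E (n0 + p)%N <= E n0.
  elim: p => [|p IH]; first by rewrite addn0.
  apply: le_trans IH; rewrite addnS /E exprS mulrAC mulrC.
  rewrite ler_wpM2l ?exprn_ge0 //.
  have := dhalf p.+1; have := d0 (n0 + p).+1; rewrite addnS.
  have : d (n0 + p).+1 * (2 - d (n0 + p).+1) <= d (n0 + p)%N.
    rewrite (dM (n0 + p)%N) ler_wpM2l // lerBlDr.
    rewrite -(@normc_nat R 2) (_ : 2%:R = x (n0 + p).+1 + 1 - (x (n0 + p).+1 - 1)).
      exact: ler_normcB.
    by ring.
  have := d0 (n0 + p)%N.
  set u := d (n0 + p)%N; set v := d (n0 + p).+1 => u0 h v0 v1.
  have h2 : v * (2 - v) * (1 + 4 * (v * (2 - v))) <= u * (1 + 4 * u).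
    have : 0 <= v * (2 - v) by nra.
    by nra.
  apply: le_trans h2; have : 0 <= v ^+ 2 * ((1 / 2 - v) * (14 - 4 * v)).
    by rewrite mulr_ge0 ?sqr_ge0 // mulr_ge0 //; lra.
  by lra.
(* [E n0] handles the indices from [n0] on, the finite sum the earlier ones. *)
exists (E n0 + \sum_(0 <= i < n0) 2 ^+ i * d i).
  rewrite addr_ge0 ?sumr_ge0 // /E => *; rewrite ?mulr_ge0 ?exprn_ge0 //.
  by rewrite addr_ge0 // mulr_ge0.
move=> n; have [nn0|n0n] := ltnP n n0.
  rewrite -[leLHS]add0r lerD //.
    by rewrite /E !mulr_ge0 ?exprn_ge0 // addr_ge0 // mulr_ge0.
  rewrite big_mkord (bigD1 (Ordinal nn0)) //= lerDl sumr_ge0 // => i _.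
  by rewrite mulr_ge0 // exprn_ge0.
rewrite -[leLHS]addr0 lerD ?sumr_ge0 // => [|i _]; last first.
  by rewrite mulr_ge0 // exprn_ge0.
apply: le_trans (Ele (n - n0)%N); rewrite subnKC // /E.
apply: ler_wpM2l; first exact: exprn_ge0.
by rewrite -/(d n); have := d0 n; nra.
Qed.

Lemma root2_bound x : x != 0 -> normc x <= 1 ->
  exists2 C : R, 0 <= C & forall n, 2 ^+ n * normc (root2 x n - 1) <= C.
Proof.
(* Index 0 is excluded: [root2 x 0] is [x] itself, whose real part may be negative. *)
move=> x0 x1; apply: (@sqr_seq_bound _ 1) => // [n|[//|n] _].
  exact: root2_sqr.
exact: Re_csqrt.
Qed.

Lemma zeta_bound :
  exists2 C : R, 0 <= C & forall n, 2 ^+ n * normc (zeta n - 1) <= C.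
Proof.
(* Starting at 2 skips [zeta R 1], which is -1. *)
apply: (@sqr_seq_bound _ 2) => [n|||[|[|n]] // _]; first exact: zeta_sqr.
- exact: oner_neq0.
- by rewrite normc1E.
- exact: Re_csqrt.
Qed.

(** The power of exponent 2^(n-1) minus 1 is -2, and it is zeta - 1 times a sum of 2^(n-1) terms of
    modulus 1. The bound lets the weight [zeta R n - 1] be divided out of boundary sums. *)
Lemma zeta_lower n : (0 < n)%N -> 1 <= 2 ^+ n * normc (zeta n - 1).
Proof.
case: n => // n _; have : normc (zeta n.+1 ^+ (2 ^ n) - 1) = 2.
  by rewrite zeta_half (_ : -1 - 1 = - 2%:R) ?normcNE ?normc_nat //; ring.
rewrite subrX1 normcM => h.
have : normc (\sum_(i < 2 ^ n) zeta n.+1 ^+ i) <= 2 ^+ n.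
  apply: le_trans (ler_normc_sum _ _ _) _.
  rewrite (eq_bigr (fun=> 1)) => [|i _]; last by rewrite normc_zetaX.
  by rewrite sumr_const card_ord natrX.
have := normc_ge0 (zeta n.+1 - 1); move: h; rewrite exprS.
have : 1 <= 2 ^+ n :> R by rewrite exprn_ege1 // ler1n.
by nra.
Qed.

End Roots.

(** * Discrete Goursat theorem *)

Lemma sum_nat_double (V : zmodType) m (F : nat -> V) :
  \sum_(0 <= k < m + m) F k =
  \sum_(0 <= k < m) F k + \sum_(0 <= k < m) F (m + k)%N.
Proof.
rewrite (@big_cat_nat _ _ _ m) ?leq_addr //=; congr (_ + _).
by rewrite -{1}[m]add0n big_addn addnK; apply: eq_bigr => i _; rewrite addnC.
Qed.

(** * Bisection of dyadic blocks *)

Section Bisection.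
Variables (R : realType) (T : nat -> nat -> nat -> R[i]).

(** [m] is the level of the block [ij] and [p] the further depth of its subdivision into cells of
    level [m + p]. *)
Definition block_sum m (ij : nat * nat) p : R[i] :=
  \sum_(0 <= k < 2 ^ p) \sum_(0 <= l < 2 ^ p)
    T (m + p) (ij.1 * 2 ^ p + k) (ij.2 * 2 ^ p + l).

Lemma block_sumS m ij p : block_sum m ij p.+1 =
  block_sum m.+1 (ij.1.*2, ij.2.*2)%N p + block_sum m.+1 (ij.1.*2, ij.2.*2.+1)%N p
  + (block_sum m.+1 (ij.1.*2.+1, ij.2.*2)%N p
     + block_sum m.+1 (ij.1.*2.+1, ij.2.*2.+1)%N p).
Proof.
rewrite /block_sum /= -!addnn expnS mul2n -addnn sum_nat_double -!big_split /=.
apply: eq_bigr => k _; rewrite !sum_nat_double; congr (_ + _ + (_ + _));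
  by apply: eq_bigr => l _; congr T; lia.
Qed.

(** If the four children of a block all satisfied the opposite bound for every large [p], adding up
    would contradict the bound on the parent: the number of children is the factor gained in
    [4 ^+ m]. The halving conditions express nesting. *)
Lemma bisection (eta : R) :
  (forall N, exists2 p, (N <= p)%N & eta < normc (block_sum 0 (0, 0)%N p)) ->
  exists I : nat -> nat * nat,
    [/\ I 0%N = (0, 0)%N,
        forall m, (I m.+1).1./2 = (I m).1 /\ (I m.+1).2./2 = (I m).2 &
        forall m, exists p, eta < 4 ^+ m * normc (block_sum m (I m) p)].
Proof.
(* Validity at arbitrarily large depths is what a child inherits: depth drops by one at each
   subdivision, and each of the four children may have its own threshold. *)
pose freq m ij := forall N, exists2 p, (N <= p)%N &
  eta < 4 ^+ m * normc (block_sum m ij p).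
move=> h0.
have step (mij : nat * (nat * nat)) : exists ij', freq mij.1 mij.2 ->
    freq mij.1.+1 ij' /\ (ij'.1./2 = mij.2.1 /\ ij'.2./2 = mij.2.2).
  case: mij => m ij /=; apply: contrapT => /forallNP hn.
  have [fm|nfm] := pselect (freq m ij); last by apply: (hn ij) => /nfm.
  have child a b : a./2 = ij.1 -> b./2 = ij.2 ->
      exists N, forall p, (N <= p)%N ->
        4 ^+ m.+1 * normc (block_sum m.+1 (a, b) p) <= eta.
    move=> ha hb; have : ~ freq m.+1 (a, b) by move=> fab; apply: (hn (a, b)).
    move=> /existsNP[N hN]; exists N => p Np; rewrite leNgt; apply/negP => hp.
    by apply: hN; exists p.
  have e0 i : i.*2./2 = i by rewrite doubleK.
  have e1 i : i.*2.+1./2 = i by rewrite /= uphalf_double.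
  have [N1 h1] := child _ _ (e0 ij.1) (e0 ij.2).
  have [N2 h2] := child _ _ (e0 ij.1) (e1 ij.2).
  have [N3 h3] := child _ _ (e1 ij.1) (e0 ij.2).
  have [N4 h4] := child _ _ (e1 ij.1) (e1 ij.2).
  have [[|p]] := fm (N1 + N2 + N3 + N4).+1%N; first by rewrite ltn0.
  rewrite ltnS => Np; rewrite ltNge => /negP; apply; rewrite block_sumS.
  have {h1 h2 h3 h4} [] : [/\ 4 ^+ m.+1 * normc (block_sum m.+1 (ij.1.*2, ij.2.*2)%N p) <= eta,
    4 ^+ m.+1 * normc (block_sum m.+1 (ij.1.*2, ij.2.*2.+1)%N p) <= eta,
    4 ^+ m.+1 * normc (block_sum m.+1 (ij.1.*2.+1, ij.2.*2)%N p) <= eta &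
    4 ^+ m.+1 * normc (block_sum m.+1 (ij.1.*2.+1, ij.2.*2.+1)%N p) <= eta].
    by split; [apply: h1|apply: h2|apply: h3|apply: h4]; lia.
  set A := block_sum _ _ _; set B := block_sum _ _ _; set C := block_sum _ _ _.
  set D := block_sum _ _ _; rewrite exprS => hA hB hC hD.
  have : normc (A + B + (C + D)) <= normc A + normc B + (normc C + normc D).
    by rewrite (le_trans (ler_normcD _ _)) // lerD // ler_normcD.
  have : 0 <= 4 ^+ m :> R by rewrite exprn_ge0.
  move: hA hB hC hD; set q : R := 4 ^+ m; set a := normc A; set b := normc B.
  set c := normc C; set d := normc D => hA hB hC hD q0 /(ler_wpM2l q0).
  lra.
have [g hg] := choice step.
pose I := fix I m := if m is m'.+1 then g (m', I m') else (0, 0)%N.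
have hI m : freq m (I m).
  elim: m => [|m IH /=]; last by have [] := hg (m, I m) IH.
  by move=> N; have [p Np hp] := h0 N; exists p => //; rewrite mul1r.
exists I; split => // m; first by have [] := hg (m, I m) (hI m).
by have [p _ hp] := hI m 0%N; exists p.
Qed.

Lemma bisection_index (I : nat -> nat * nat) (f : nat * nat -> nat) m p :
  (forall m, (f (I m.+1))./2 = f (I m)) ->
  (f (I m) * 2 ^ p <= f (I (m + p)%N) < (f (I m)).+1 * 2 ^ p)%N.
Proof.
move=> h; elim: p => [|p /andP[IH1 IH2]]; first by rewrite addn0 expn0; lia.
by have := h (m + p)%N; rewrite addnS expnS; nia.
Qed.

End Bisection.

(** * Cells of the polar grid *)

Section Goursat.
Variable R : realType.
Implicit Types h : R[i] -> R[i].

Definition avg n (phi : R[i] -> R[i]) : R[i] :=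
  (2 ^+ n)^-1 * \sum_(0 <= j < 2 ^ n) phi (zeta R n ^+ j).

Lemma derivable_approx h (z : R[i]) : derivable h z 1 ->
  exists a : R[i], forall e : R, 0 < e -> exists2 d, 0 < d &
    forall x, normc (x - z) < d ->
      normc (h x - h z - a * (x - z)) <= e * normc (x - z).
Proof.
move=> /cvg_ex[/= a /cvgrPdist_lt ha]; exists a => e e0.
have e0' : 0 < e%:C%C by rewrite ltcR.
have /nbhs_ballP[d /= d0 hd] := ha _ e0'.
have dR : d = (complex.Re d)%:C%C by rewrite RRe_real // gtr0_real.
have dR0 : 0 < complex.Re d by rewrite -ltcR -dR.
exists (complex.Re d) => // x xd; have [->|xz] := eqVneq x z.
  by rewrite !subrr mulr0 subrr normc0E mulr0.
have xz0 : x - z != 0 by rewrite subr_eq0.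
have /hd /(_ xz0) : ball 0 d (x - z).
  by rewrite /ball /= sub0r normrN normrC dR ltcR.
rewrite normrC ltcR /= -[(x - z) *: 1]/((x - z) * 1) mulr1 subrK.
rewrite -[_ *: _]/((x - z)^-1 * (h x - h z)) => hx.
have -> : h x - h z - a * (x - z) =
    (x - z) * - (a - (x - z)^-1 * (h x - h z)).
  by rewrite opprB [RHS]mulrBr mulrA mulfV // mul1r [a * _]mulrC.
by rewrite normcM normcNE mulrC ler_wpM2r ?normc_ge0 // ltW.
Qed.

Variables (rho : R[i]).
Hypotheses (rho0 : rho != 0) (rho1 : normc rho <= 1).

Definition grid n i j : R[i] := root2 rho n ^+ i * zeta R n ^+ j.

(* A discrete version of the integral of h(z)dz/z over the boundary of the cell
   with corner z = grid n i j: the weights zeta - 1 and rho - 1 stand for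
   dz/z along the sides and make the sum vanish exactly on affine functions. *)
Definition cell h n i j : R[i] :=
  (zeta R n - 1) * (h (grid n i.+1 j) - h (grid n i j))
  - (root2 rho n - 1) * (h (grid n i j.+1) - h (grid n i j)).

Lemma gridSl n i j : grid n i.+1 j = root2 rho n * grid n i j.
Proof. by rewrite /grid exprS mulrA. Qed.

Lemma gridSr n i j : grid n i j.+1 = zeta R n * grid n i j.
Proof. by rewrite /grid exprS mulrCA. Qed.

Lemma cell_affine a b n i j : cell (fun z => a + b * z) n i j = 0.
Proof. by rewrite /cell gridSl gridSr; ring. Qed.

Lemma cell_sub h1 h2 n i j :
  cell (fun z => h1 z - h2 z) n i j = cell h1 n i j - cell h2 n i j.
Proof. by rewrite /cell; ring. Qed.

(** Each of the two differences telescopes along its own direction, so interior contributions cancel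
    and only the sides of the block remain. *)
Lemma cell_telescope h n a b M : \sum_(0 <= k < M) \sum_(0 <= l < M)
    cell h n (a + k) (b + l) =
  (zeta R n - 1) * \sum_(0 <= l < M)
     (h (grid n (a + M) (b + l)) - h (grid n a (b + l)))
  - (root2 rho n - 1) * \sum_(0 <= k < M)
     (h (grid n (a + k) (b + M)) - h (grid n (a + k) b)).
Proof.
rewrite /cell.
under eq_bigr => k _.
  rewrite sumrB -!mulr_sumr -addnS.
  under [X in _ - _ * X]eq_bigr => l _ do rewrite -addnS.
  rewrite (@telescope_sumr _ 0%N M (fun l => h (grid n (a + k) (b + l)))) // addn0.
  over.
rewrite sumrB -!mulr_sumr exchange_big /=; congr (_ * _ - _).
apply: eq_bigr => l _.
under eq_bigr => k _ do rewrite addnS -addnS.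
by rewrite (@telescope_sumr _ 0%N M (fun k => h (grid n (a + k) (b + l)))) // addn0.
Qed.

End Goursat.

(** * Comparison of the means over two circles *)

Section GoursatTheorem.
Variable R : realType.
Variables (rho : R[i]).
Hypotheses (rho0 : rho != 0) (rho1 : normc rho <= 1).

Lemma grid_add m p i j k l :
  grid rho (m + p) (i * 2 ^ p + k) (j * 2 ^ p + l) =
  grid rho m i j * (root2 rho (m + p) ^+ k * zeta R (m + p) ^+ l).
Proof.
rewrite /grid !exprD ![(_ * 2 ^ p)%N]mulnC !exprM.
rewrite (sqr_seqX (root2_sqr rho)) (sqr_seqX (@zeta_sqr R)).
by rewrite mulrACA.
Qed.

Lemma normc_grid n i j : (i <= 2 ^ n)%N -> normc rho <= normc (grid rho n i j) <= 1.
Proof.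
move=> i2; rewrite /grid normcM normc_zetaX mulr1 normcX.
have /andP[_ r1] := sqr_seq_norm (root2_sqr rho) rho1 n.
rewrite exprn_ile1 ?normc_ge0 // andbT -{1}(root2X rho n) normcX.
by rewrite ler_wiXn2l ?normc_ge0.
Qed.

Lemma subX1_bound (x : R[i]) k : normc x <= 1 ->
  normc (x ^+ k - 1) <= k%:R * normc (x - 1).
Proof.
move=> x1; rewrite subrX1 normcM mulrC ler_wpM2r ?normc_ge0 //.
apply: le_trans (ler_normc_sum _ _ _) _.
apply: (@le_trans _ _ (\sum_(i < k) 1)).
  by apply: ler_sum => i _; rewrite normcX exprn_ile1 ?normc_ge0.
by rewrite sumr_const card_ord.
Qed.

(** Inside the block the corner is multiplied by r^k z^l with k, l <= 2^p, and |r^k - 1| <= 2^p |r -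
    1| <= C1 / 2^m, likewise for z with C2. The bound is independent of [p]. *)
Lemma grid_dist (C1 C2 : R) m p i j k l :
  (forall n, 2 ^+ n * normc (root2 rho n - 1) <= C1) ->
  (forall n, 2 ^+ n * normc (zeta R n - 1) <= C2) ->
  (i <= 2 ^ m)%N -> (k <= 2 ^ p)%N -> (l <= 2 ^ p)%N ->
  normc (grid rho (m + p) (i * 2 ^ p + k) (j * 2 ^ p + l) - grid rho m i j)
    <= (C1 + C2) / 2 ^+ m.
Proof.
move=> hC1 hC2 im kp lp; rewrite grid_add.
set g := grid _ _ _ _; set r := root2 _ _; set z := zeta _ _.
have /andP[_ g1] : normc rho <= normc g <= 1 by exact: normc_grid.
have /andP[_ r1] : normc (root2 rho 0) <= normc r <= 1.
  exact: sqr_seq_norm (root2_sqr rho) rho1 _.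
have -> : g * (r ^+ k * z ^+ l) - g = g * (z ^+ l * (r ^+ k - 1) + (z ^+ l - 1)).
  by ring.
rewrite normcM -[leRHS]mul1r ler_pM ?normc_ge0 //.
rewrite (le_trans (ler_normcD _ _)) // normcM normc_zetaX mul1r mulrDl lerD //.
  rewrite ler_pdivlMr ?exprn_gt0 // (le_trans _ (hC1 (m + p)%N)) //.
  rewrite mulrC exprD -mulrA ler_wpM2l ?exprn_ge0 //.
  rewrite (le_trans (subX1_bound _ r1)) // ler_wpM2r ?normc_ge0 //.
  by rewrite -natrX ler_nat.
rewrite ler_pdivlMr ?exprn_gt0 // (le_trans _ (hC2 (m + p)%N)) //.
rewrite mulrC exprD -mulrA ler_wpM2l ?exprn_ge0 //.
rewrite (le_trans (subX1_bound _ _)) ?normc_zeta // ler_wpM2r ?normc_ge0 //.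
by rewrite -natrX ler_nat.
Qed.

(** The radial sides j = 0 and j = 2^p coincide because [zeta R p] has 2^p-th power 1, so they
    cancel; the circles of radius |rho| and 1 are left. *)
Lemma block_sum_avg (h : R[i] -> R[i]) p : block_sum (cell rho h) 0 (0, 0)%N p =
  (zeta R p - 1) * (2 ^+ p * (avg p (fun u => h (rho * u)) - avg p h)).
Proof.
rewrite /block_sum /= !mul0n (cell_telescope rho h (0 + p)%N 0 0).
rewrite !add0n [X in _ - _ * X]big1 ?mulr0 ?subr0 => [|k _]; last first.
  by rewrite /grid zetaX expr0 subrr.
congr (_ * _); rewrite /avg -mulrBr mulVKf ?expf_neq0 ?pnatr_eq0 //.
rewrite -sumrB; apply: eq_bigr => l _.
by rewrite add0n /grid root2X expr0 mul1r.
Qed.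

(** Subtracting an affine function does not change the sum. Each side of the block then has 2^p
    terms of size [e] and a weight of order 2^-(m+p), so [p] drops out of the bound. *)
Lemma block_sum_bound (h : R[i] -> R[i]) (a b : R[i]) (e C1 C2 : R) m ij p :
  (forall n, 2 ^+ n * normc (root2 rho n - 1) <= C1) ->
  (forall n, 2 ^+ n * normc (zeta R n - 1) <= C2) ->
  (forall k l, (k <= 2 ^ p)%N -> (l <= 2 ^ p)%N ->
    let z := grid rho (m + p) (ij.1 * 2 ^ p + k) (ij.2 * 2 ^ p + l) in
    normc (h z - (a + b * z)) <= e) ->
  normc (block_sum (cell rho h) m ij p) <= (C1 + C2) / 2 ^+ m * (2 * e).
Proof.
move=> hC1 hC2 he; pose r z := h z - (a + b * z).
have -> : block_sum (cell rho h) m ij p = block_sum (cell rho r) m ij p.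
  apply: eq_bigr => k _; apply: eq_bigr => l _.
  by rewrite cell_sub cell_affine subr0.
rewrite /block_sum cell_telescope; set i0 := (_ * _)%N; set j0 := (_ * _)%N.
have edge (w : R[i]) C (F G : nat -> R[i]) : 2 ^+ (m + p) * normc (w - 1) <= C ->
    (forall l, (l < 2 ^ p)%N -> normc (F l) <= e /\ normc (G l) <= e) ->
    normc ((w - 1) * \sum_(0 <= l < 2 ^ p) (F l - G l)) <= C / 2 ^+ m * (2 * e).
  move=> hw FG; rewrite normcM.
  have : normc (\sum_(0 <= l < 2 ^ p) (F l - G l)) <= 2 ^+ p * (2 * e).
    apply: le_trans (ler_normc_sum _ _ _) _.
    rewrite big_mkord (@le_trans _ _ (\sum_(l < 2 ^ p) (2 * e))) //.
      apply: ler_sum => l _; have [Fe Ge] := FG l (ltn_ord l).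
      by rewrite (le_trans (ler_normcB _ _)) // mulr2n mulrDl mul1r lerD.
    by rewrite sumr_const card_ord -[leLHS]mulr_natl natrX.
  move=> /(ler_wpM2l (normc_ge0 (w - 1))) /le_trans; apply.
  have e0 : 0 <= e.
    have p0 : (0 < 2 ^ p)%N by rewrite expn_gt0.
    by have [Fe _] := FG 0%N p0; apply: le_trans Fe; exact: normc_ge0.
  rewrite [leLHS]mulrA ler_wpM2r ?mulr_ge0 // ler_pdivlMr ?exprn_gt0 //.
  by apply: le_trans hw; rewrite exprD -mulrA mulrC [2 ^+ p * _]mulrC.
rewrite (le_trans (ler_normcB _ _)) //.
rewrite [(C1 + C2)%R]addrC [(C2 + C1) / _]mulrDl [leRHS]mulrDl lerD //.
  apply: edge => [|l lp]; first exact: hC2.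
  split; first by apply: he => //; exact: ltnW.
  by rewrite -[i0]addn0; apply: he => //; exact: ltnW.
apply: edge => [|l lp]; first exact: hC1.
split; first by apply: he => //; exact: ltnW.
by rewrite -[j0]addn0; apply: he => //; exact: ltnW.
Qed.

(** Near the limit point of the nested blocks, [block_sum_bound] with the first-order expansion
    gives sums o(4^-m), against the lower bound of order 4^-m from [bisection]. *)
Lemma avg_annulus (h : R[i] -> R[i]) :
  (forall z : R[i], normc rho <= normc z <= 1 -> derivable h z 1) ->
  (fun n => avg n (fun u => h (rho * u)) - avg n h) @ \oo --> (0 : R[i]).
Proof.
move=> hd; apply/cvgCP; apply: contrapT => /existsNP[e /not_implyP[e0 hN]].
(* The difference of means is multiplied by [2 ^+ p * (zeta R p - 1)], of modulus at least 1 for p >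
   0, hence the shift to [N.+1]; halving [e] makes the inequality strict. *)
have {}hN N : exists2 p, (N <= p)%N &
    e / 2 < normc (block_sum (cell rho h) 0 (0, 0)%N p).
  apply: contrapT => hn; apply: hN; exists N.+1 => p Np.
  rewrite subr0 ltNge; apply/negP => hp; apply: hn; exists p; first exact: ltnW.
  have p0 : (0 < p)%N by apply: leq_trans Np.
  rewrite block_sum_avg mulrA normcM (@lt_le_trans _ _ e) //; first lra.
  rewrite (le_trans hp) // -[leLHS]mul1r ler_wpM2r ?normc_ge0 //.
  by rewrite normcM mulrC normcX normc_nat zeta_lower.
have [I [I0 Ihalf Isum]] := bisection hN.
have [C1 C10 hC1] := root2_bound rho0 rho1.
have [C2 C20 hC2] := zeta_bound R.
pose a m := grid rho m (I m).1 (I m).2.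
have bnd (f : nat * nat -> nat) m p :
    (forall m, (f (I m.+1))./2 = f (I m)) -> f (0, 0)%N = 0%N ->
    [/\ (f (I m) <= 2 ^ m)%N &
      exists2 k, (k <= 2 ^ p)%N & f (I (m + p)%N) = (f (I m) * 2 ^ p + k)%N].
  move=> hf f0; split.
    have := @bisection_index I f 0%N m hf; rewrite I0 f0 mul0n mul1n add0n.
    by move=> /andP[_ /ltnW].
  have /andP[h1 h2] := @bisection_index I f m p hf.
  exists (f (I (m + p)) - f (I m) * 2 ^ p)%N; lia.
have half1 m : (I m.+1).1./2 = (I m).1 by have [] := Ihalf m.
have half2 m : (I m.+1).2./2 = (I m).2 by have [] := Ihalf m.
pose C := C1 + C2.
have C0 : 0 <= C by rewrite addr_ge0.
have near_a m p : normc (a (m + p)%N - a m) <= C / 2 ^+ m.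
  have [im [k kp iE]] := bnd fst m p half1 erefl.
  have [jm [l lp jE]] := bnd snd m p half2 erefl.
  by rewrite /a iE jE; exact: grid_dist.
have small (d : R) : 0 < d -> exists m, C / 2 ^+ m < d by exact: exists_pow2_lt.
have /cvg_ex[/= z az] : cvgn a.
  apply: cvgC_cauchy => d /small[N hN']; exists N => n Nn.
  by rewrite -(subnKC Nn) (le_lt_trans (near_a _ _)).
have near_z m : normc (z - a m) <= C / 2 ^+ m.
  apply: (cvgC_le (N := m) az) => n mn; by rewrite -(subnKC mn) near_a.
have z_annulus : normc rho <= normc z <= 1.
  have aI m : normc rho <= normc (a m) <= 1.
    by apply: normc_grid; have [] := bnd fst m 0%N half1 erefl.
  apply/andP; split; apply/ler_addgt0Pl => d /small[m hm];
    have := near_z m; have /andP[a1 a2] := aI m.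
    by have := ler_normc_sub (a m) z; rewrite normcBC; lra.
  by have := ler_normc_sub z (a m); lra.
have [b hb] := derivable_approx (hd _ z_annulus).
(* The final estimate, multiplied by 4^m, is 4 C^2 eps, which this choice keeps below e/2; the added
   1 covers C = 0. *)
pose eps := e / (4 * (4 * C ^+ 2 + 1)).
have K0 : 0 < 4 * C ^+ 2 + 1 by have := sqr_ge0 C; lra.
have eps0 : 0 < eps by rewrite divr_gt0 // mulr_gt0.
have [d d0 hd'] := hb _ eps0.
have [|m hm] := small (d / 2); first lra.
have [p hp] := Isum m.
have [im _] := bnd fst m p half1 erefl.
have [jm _] := bnd snd m p half2 erefl.
(* The affine comparison function is the tangent h(z) + b(w - z), and every [w] of the block is
   within 2C/2^m of [z]. *)
have := @block_sum_bound h (h z - b * z) b (eps * (2 * (C / 2 ^+ m))) C1 C2 m (I m) p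
  hC1 hC2.
have loc k l : (k <= 2 ^ p)%N -> (l <= 2 ^ p)%N ->
    let w := grid rho (m + p) ((I m).1 * 2 ^ p + k) ((I m).2 * 2 ^ p + l) in
    normc (h w - (h z - b * z + b * w)) <= eps * (2 * (C / 2 ^+ m)).
  move=> kp lp /=; set w := grid _ _ _ _.
  have wz : normc (w - z) <= 2 * (C / 2 ^+ m).
    apply: le_trans (ler_normc_dist _ (a m) _) _.
    rewrite mulr2n mulrDl mul1r lerD //; first exact: grid_dist.
    by rewrite normcBC.
  have -> : h w - (h z - b * z + b * w) = h w - h z - b * (w - z) by ring.
  apply: le_trans (hd' w _) _; first by lra.
  by rewrite ler_wpM2l // ltW.
move=> /(_ loc); rewrite leNgt => /negP; apply.
have q0 : 0 < 2 ^+ m :> R by rewrite exprn_gt0.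
have q4 : 4 ^+ m = (2 ^+ m) ^+ 2 :> R by rewrite -exprM mulnC exprM expr2 -natrM.
rewrite -(@ltr_pM2l _ (4 ^+ m)) ?exprn_gt0 //; apply: le_lt_trans hp.
have key (q c t : R) : q != 0 ->
    q ^+ 2 * (c / q * (2 * (t * (2 * (c / q))))) = t * (4 * c ^+ 2).
  by move=> q_neq0; field.
rewrite -/C q4 key ?gt_eqF //.
rewrite /eps mulrAC ler_pdivrMr; last lra.
rewrite -subr_ge0; have := sqr_ge0 C; nra.
Qed.

End GoursatTheorem.

(** * Compactness and circle means *)

Section Compactness.
Variable R : realType.

Lemma near_ballC (T : pseudoMetricType R[i]) (x : T) (A : set T) : nbhs x A ->
  exists2 d : R, 0 < d & forall y, ball x d%:C%C y -> A y.
Proof.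
move=> /nbhs_ballP[d /= d0 hd]; exists (complex.Re d).
  by rewrite -ltcR RRe_real ?gtr0_real.
by move=> y; rewrite RRe_real ?gtr0_real //; exact: hd.
Qed.

Lemma ballCE (x y : R[i]) (d : R) : ball x d%:C%C y <-> normc (x - y) < d.
Proof. by rewrite /ball /= normrC ltcR. Qed.

Lemma continuousC_near (T : pseudoMetricType R[i]) (f : T -> R[i]) x (e : R) :
  {for x, continuous f} -> 0 < e ->
  exists2 d : R, 0 < d & forall y, ball x d%:C%C y -> normc (f x - f y) < e.
Proof.
move=> /cvgrPdist_lt fx e0; have e0' : 0 < e%:C%C by rewrite ltcR.
have [d d0 hd] := near_ballC (fx _ e0'); exists d => // y /hd.
by rewrite normrC ltcR.
Qed.

Lemma compact_normc_bounded (T : pseudoMetricType R[i]) (K : set T) (f : T -> R[i]) :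
  compact K -> (forall x, K x -> {for x, continuous f}) ->
  exists2 S : R, 0 <= S & forall x, K x -> normc (f x) <= S.
Proof.
move=> /compact_near_coveringP cK fK.
have [|N _ hN] := cK nat \oo (fun n x => normc (f x) <= n%:R) _.
  move=> x Kx; have [d d0 hd] := continuousC_near (fK x Kx) ltr01.
  exists (ball x d%:C%C, [set n | (Num.bound (normc (f x) + 1) <= n)%N]).
    split; first by apply: nbhsx_ballx; rewrite ltcR.
    by exists (Num.bound (normc (f x) + 1)).
  move=> [y n] /= [/hd xy hn].
  have b : normc (f x) + 1 < (Num.bound (normc (f x) + 1))%:R.
    by apply: archi_boundP; rewrite addr_ge0 ?normc_ge0.
  have : (Num.bound (normc (f x) + 1))%:R <= n%:R :> R by rewrite ler_nat.
  by have := ler_normc_sub (f y) (f x); rewrite normcBC; lra.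
by exists N%:R => // x Kx; exact: (hN N (leqnn N)).
Qed.

(** The near-covering form of compactness, along the radii 1/(n+1), turns the local radii d/2 into a
    single one. *)
Lemma compact_unif_continuous (T : pseudoMetricType R[i]) (K : set T) (f : T -> R[i]) :
  compact K -> (forall x, K x -> {for x, continuous f}) ->
  forall e : R, 0 < e -> exists2 d : R, 0 < d &
    forall x y, K x -> ball x d%:C%C y -> normc (f x - f y) < e.
Proof.
move=> /compact_near_coveringP cK fK e e0.
have e20 : 0 < e / 2 by lra.
have [|N _ hN] := cK nat \oo (fun n x => forall y, ball x (n.+1%:R^-1 : R)%:C%C y ->
    normc (f x - f y) < e) _.
  move=> x Kx; have [d d0 hd] := continuousC_near (fK x Kx) e20.
  have d20 : 0 < d / 2 by lra.
  exists (ball x (d / 2)%:C%C, [set n | (Num.bound (d / 2)^-1 <= n)%N]).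
    split; first by apply: nbhsx_ballx; rewrite ltcR.
    by exists (Num.bound (d / 2)^-1).
  move=> [x' n] /= [xx' hn] y x'y.
  have b : (d / 2)^-1 < (Num.bound (d / 2)^-1)%:R.
    by apply: archi_boundP; rewrite invr_ge0 ltW.
  have nd : n.+1%:R^-1 <= d / 2 :> R.
    rewrite -[d / 2]invrK lef_pV2 ?posrE ?invr_gt0 // (le_trans (ltW b)) //.
    by rewrite ler_nat ltnW.
  have dE : d%:C%C = (d / 2)%:C%C + (d / 2)%:C%C by rewrite -rmorphD /= -splitr.
  have xy : ball x d%:C%C y.
    rewrite dE; apply: ball_triangle xx' _; apply: le_ball x'y.
    by rewrite lecR.
  have xx'' : ball x d%:C%C x' by apply: le_ball xx'; rewrite lecR; lra.
  have := hd _ xx''; have := hd _ xy; have := ler_normc_dist (f x') (f x) (f y).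
  by rewrite [normc (f x' - f x)]normcBC; lra.
by exists N.+1%:R^-1; rewrite ?invr_gt0 // => x y Kx; exact: (hN N (leqnn N)).
Qed.

Lemma normc_continuous : continuous (@normc R).
Proof.
move=> x; apply/(@cvgrPdist_lt _ _ _ (nbhs x) (nbhs_filter x)) => e e0.
have e0' : 0 < e%:C%C :> R[i] by rewrite ltcR.
apply/nbhs_ballP; exists e%:C%C => //= y /ballCE.
apply: le_lt_trans; rewrite ler_norml ler_normc_sub andbT.
by rewrite lerNl opprB normcBC ler_normc_sub.
Qed.

Lemma complex_continuous : continuous (fun p : R * R => (p.1 +i* p.2)%C : R[i]).
Proof.
move=> p; apply/cvgrPdist_lt => e e0.
have eE : e = (complex.Re e)%:C%C by rewrite RRe_real // gtr0_real.
have eR : 0 < complex.Re e / 2 by rewrite divr_gt0 // -ltcR -eE.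
near=> q; rewrite eE normrC ltcR.
have [h1 h2] : ball p (complex.Re e / 2) q by near: q; exact: (@nbhsx_ballx _ (R * R)%type p _ eR).
rewrite (le_lt_trans (normc_ReIm _)) // ReB ImB /=.
by move: h1 h2; rewrite /ball /=; lra.
Unshelve. all: by end_near. Qed.

Lemma compact_disc : compact [set z : R[i] | normc z <= 1].
Proof.
have cQ : compact (`[-1, 1]%classic `*` `[-1, 1]%classic : set (R * R)).
  by apply: compact_setX; exact: segment_compact.
have cI := continuous_compact (continuous_subspaceT complex_continuous) cQ.
apply: subclosed_compact cI _.
  have -> : [set z : R[i] | normc z <= 1] = @normc R @^-1` [set x | x <= 1] by [].
  by apply: closed_comp => [x _|]; [exact: normc_continuous|exact: closed_le].
move=> [a b] /= ab; exists (a, b) => //=.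
have := le_trans (normc_Re (a +i* b)%C) ab.
have := le_trans (normc_Im (a +i* b)%C) ab.
by rewrite !ler_norml /= !in_itv /=.
Qed.

Lemma compact_circle : compact [set z : R[i] | normc z = 1].
Proof.
apply: subclosed_compact compact_disc _ => [|z /= ->]; last exact: lexx.
have -> : [set z : R[i] | normc z = 1] = @normc R @^-1` [set x | x = 1] by [].
by apply: closed_comp => [x _|]; [exact: normc_continuous|exact: closed_eq].
Qed.

End Compactness.

(** * Means over roots of unity *)

Section Averages.
Variable R : realType.
Implicit Types (phi psi : R[i] -> R[i]) (u v : R[i]).

Lemma pow2_neq0 n : 2 ^+ n != 0 :> R[i].
Proof. by rewrite expf_neq0 // pnatr_eq0. Qed.

Lemma eq_avg n phi psi : (forall u, normc u = 1 -> phi u = psi u) ->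
  avg n phi = avg n psi.
Proof.
by move=> h; congr (_ * _); apply: eq_bigr => j _; rewrite h // normc_zetaX.
Qed.

Lemma avg_le n phi (B : R) : (forall u, normc u = 1 -> normc (phi u) <= B) ->
  normc (avg n phi) <= B.
Proof.
move=> h; rewrite normcM normcV normcX normc_nat mulrC ler_pdivrMr ?exprn_gt0 //.
apply: le_trans (ler_normc_sum _ _ _) _; rewrite big_mkord.
rewrite (@le_trans _ _ (\sum_(j < 2 ^ n) B)) //.
  by apply: ler_sum => j _; rewrite h // normc_zetaX.
by rewrite sumr_const card_ord -[leLHS]mulr_natr natrX.
Qed.

Lemma avgB n phi psi : avg n phi - avg n psi = avg n (fun u => phi u - psi u).
Proof. by rewrite -mulrBr -sumrB. Qed.

Lemma avgZ n phi (a : R[i]) : avg n (fun u => a * phi u) = a * avg n phi.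
Proof. by rewrite /avg mulrCA -mulr_sumr. Qed.

Lemma avg_sum (I : Type) (r : seq I) (P : pred I) n (F : I -> R[i] -> R[i]) :
  avg n (fun u => \sum_(i <- r | P i) F i u) = \sum_(i <- r | P i) avg n (F i).
Proof. by rewrite /avg exchange_big mulr_sumr. Qed.

Lemma avg_cst n (a : R[i]) : avg n (fun=> a) = a.
Proof.
by rewrite /avg big_mkord sumr_const card_ord -[a *+ _]mulr_natl natrX mulKf ?pow2_neq0.
Qed.

Lemma avg_exchange n m (F : R[i] -> R[i] -> R[i]) :
  avg n (fun u => avg m (F u)) = avg m (fun v => avg n (F ^~ v)).
Proof.
rewrite /avg -mulr_sumr -mulr_sumr mulrCA; congr (_ * (_ * _)).
exact: exchange_big.
Qed.

(** The order divides 2^n; a proper divisor would make the power of exponent 2^(n-1) equal to 1,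
    whereas it is -1. *)
Lemma zeta_prim n : (2 ^ n).-primitive_root (zeta R n).
Proof.
have p0 : (0 < 2 ^ n)%N by rewrite expn_gt0.
have [m prim_m] := prim_order_exists p0 (zetaX R n).
move=> /(dvdn_pfactor _ _ (isT : prime 2))[k + mE].
rewrite leq_eqVlt => /orP[/eqP kn|kn]; first by subst k; rewrite -mE.
case: n kn prim_m {p0} => // n; rewrite ltnS => kn /prim_expr_order.
rewrite mE => zk; have := zeta_half R n.
rewrite -[in (2 ^ n)%N](subnKC kn) expnD exprM zk expr1n => /eqP.
by rewrite -subr_eq0 opprK -[1 + 1]/(2%:R) pnatr_eq0.
Qed.

(** For k != l the terms form a geometric progression whose ratio is a 2^n-th root of unity;
    exponents below 2^n guarantee that this ratio is not 1. *)
Lemma avg_ortho n k l : (k < 2 ^ n)%N -> (l < 2 ^ n)%N ->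
  avg n (fun u => u ^+ k * u^-1 ^+ l) = (k == l)%:R.
Proof.
move=> kn ln; have [->|kl] := eqVneq k l.
  rewrite (@eq_avg _ _ (fun=> 1)) ?avg_cst // => u u1.
  by rewrite exprVn mulfV // expf_neq0 // -normc_gt0 u1.
rewrite /avg; pose w := zeta R n ^+ k * (zeta R n)^-1 ^+ l.
have z0 : zeta R n ^+ l != 0 by rewrite expf_neq0 // zeta_neq0.
rewrite (eq_bigr (fun j => w ^+ j)) => [|j _]; last first.
  by rewrite /w exprMn -exprVn -!exprM ![(j * _)%N]mulnC.
suff -> : \sum_(0 <= j < 2 ^ n) w ^+ j = 0 by rewrite mulr0.
have w1 : w - 1 != 0.
  rewrite subr_eq0 /w exprVn -[_ == 1](inj_eq (mulIf z0)) mulfVK // mul1r.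
  by rewrite (eq_prim_root_expr (zeta_prim n)) !modn_small.
apply: (mulfI w1); rewrite big_mkord -subrX1 mulr0 /w exprMn -!exprM.
by rewrite mulnC [(l * _)%N]mulnC !exprM exprVn zetaX invr1 !expr1n mulr1 subrr.
Qed.

(** The coarse node of index j stands for the 2^p fine nodes of index j 2^p to (j+1) 2^p - 1, all
    within C/2^n of it. Uniformity in [p] gives the Cauchy property of the means. *)
Lemma avg_refine phi (C d e : R) n p :
  (forall m, 2 ^+ m * normc (zeta R m - 1) <= C) ->
  (forall u v, normc u = 1 -> normc v = 1 -> normc (u - v) < d ->
     normc (phi u - phi v) <= e) ->
  C / 2 ^+ n < d -> normc (avg (n + p) phi - avg n phi) <= e.
Proof.
move=> hC hphi Cd.
have avgE : avg n phi = (2 ^+ (n + p))^-1 * \sum_(0 <= j < 2 ^ n)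
    \sum_(j * 2 ^ p <= i < j.+1 * 2 ^ p) phi (zeta R n ^+ j).
  rewrite (eq_bigr (fun j => 2 ^+ p * phi (zeta R n ^+ j))) => [|j _].
    rewrite -mulr_sumr /avg mulrA; congr (_ * _).
    by rewrite exprD invfM mulfVK // pow2_neq0.
  by rewrite sumr_const_nat mulSn addnK -[LHS]mulr_natl natrX.
rewrite avgE {1}/avg expnD big_nat_mul -mulrBr -sumrB.
rewrite normcM normcV normcX normc_nat mulrC ler_pdivrMr ?exprn_gt0 //.
apply: le_trans (ler_normc_sum _ _ _) _.
apply: (@le_trans _ _ (\sum_(0 <= j < 2 ^ n) 2 ^+ p * e)); last first.
  by rewrite sumr_const_nat subn0 -[leLHS]mulr_natl natrX mulrA -exprD mulrC.
apply: ler_sum => j _; rewrite -sumrB; apply: le_trans (ler_normc_sum _ _ _) _.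
apply: (@le_trans _ _ (\sum_(j * 2 ^ p <= i < j.+1 * 2 ^ p) e)); last first.
  by rewrite sumr_const_nat mulSn addnK -[leLHS]mulr_natl natrX.
rewrite !big_nat; apply: ler_sum => i /andP[ij1 ij2].
apply: hphi; rewrite ?normc_zetaX //; apply: le_lt_trans Cd.
rewrite -(sqr_seqX (@zeta_sqr R) n p) -exprM mulnC -{1}(subnKC ij1) exprD.
rewrite -[X in _ - X]mulr1 -mulrBr normcM normc_zetaX mul1r.
rewrite (le_trans (subX1_bound _ _)) ?normc_zeta // ler_pdivlMr ?exprn_gt0 //.
rewrite (le_trans _ (hC (n + p)%N)) // mulrC exprD -mulrA.
rewrite ler_wpM2l ?exprn_ge0 // ler_wpM2r ?normc_ge0 // -natrX ler_nat.
by rewrite leq_subLR; lia.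
Qed.

Definition unif_circle phi := forall e : R, 0 < e -> exists2 d : R, 0 < d &
  forall u v, normc u = 1 -> normc v = 1 -> normc (u - v) < d ->
    normc (phi u - phi v) <= e.

Lemma avg_cvg phi : unif_circle phi -> cvgn (fun n => avg n phi).
Proof.
move=> hphi; have [C C0 hC] := zeta_bound R.
apply: cvgC_cauchy => e e0; have e20 : 0 < e / 2 by lra.
have [d d0 hd] := hphi _ e20.
have [N hN] := exists_pow2_lt C0 d0.
exists N => n Nn; rewrite -(subnKC Nn) (le_lt_trans (avg_refine _ hC hd hN)) //.
lra.
Qed.

End Averages.

(** * Taylor coefficients and Cesaro means *)

Section Coefficients.
Variable R : realType.
Implicit Types (g h phi psi : R[i] -> R[i]) (u v t z : R[i]).

Lemma derivable_continuousC g z : derivable g z 1 -> {for z, continuous g}.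
Proof. by move=> /derivable1_diffP /differentiable_continuous. Qed.

Lemma derivableCM g h z : derivable g z 1 -> derivable h z 1 ->
  derivable (fun u => g u * h u) z 1.
Proof. by move=> gz hz; have := derivableM gz hz. Qed.

Lemma derivable_idC z : derivable (fun u : R[i] => u) z 1.
Proof. exact: (@derivable_id R[i] R[i] z 1). Qed.

Lemma derivable_cstC t z : derivable (fun _ : R[i] => t) z 1.
Proof. exact: (@derivable_cst R[i] R[i] R[i] t z 1). Qed.

Lemma derivable_invC z : z != 0 -> derivable (fun u : R[i] => u^-1) z 1.
Proof.
by move=> z0; exact: (@derivableV R[i] R[i] (fun u => u) z 1 z0 (@derivable_idC z)).
Qed.

Lemma derivable_scale g t z : derivable g (t * z) 1 ->
  derivable (fun u => g (t * u)) z 1.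
Proof.
move=> /derivable1_diffP gtz; apply/derivable1_diffP.
apply: differentiable_comp; last exact: gtz.
have := derivableCM (@derivable_cstC t z) (@derivable_idC z).
by move=> /derivable1_diffP.
Qed.

Lemma derivable_mulX g l z : derivable g z 1 -> derivable (fun u => g u * u ^+ l) z 1.
Proof.
move=> gz; elim: l => [|l IH].
  by rewrite (_ : (fun _ => _) = g) //; apply/funext => u; rewrite mulr1.
rewrite (_ : (fun _ => _) = fun u => g u * u ^+ l * u); last first.
  by apply/funext => u; rewrite exprSr mulrA.
exact: (derivableCM IH (@derivable_idC z)).
Qed.

Lemma derivable_mulXV g l z : z != 0 -> derivable g z 1 ->
  derivable (fun u => g u * u^-1 ^+ l) z 1.
Proof.
move=> z0 gz; elim: l => [|l IH].
  by rewrite (_ : (fun _ => _) = g) //; apply/funext => u; rewrite mulr1.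
rewrite (_ : (fun _ => _) = fun u => g u * u^-1 ^+ l * u^-1); last first.
  by apply/funext => u; rewrite exprSr mulrA.
exact: (derivableCM IH (derivable_invC z0)).
Qed.

Lemma normc1_neq0 u : normc u = 1 -> u != 0.
Proof. by move=> u1; rewrite -normc_gt0 u1. Qed.

Lemma unif_circle_continuous phi :
  (forall u, normc u = 1 -> {for u, continuous phi}) -> unif_circle phi.
Proof.
move=> h e e0; have [d d0 hd] := compact_unif_continuous (@compact_circle R) h e0.
exists d => // u v u1 v1 uv; apply/ltW/hd => //; exact/ballCE.
Qed.

(** Discrete counterpart of the Cauchy integral for a Taylor coefficient. [limn] makes it total;
    [coef_cvg] shows that the limit exists. *)
Definition coef g m : R[i] := limn (fun n => avg n (fun u => g u * u^-1 ^+ m)).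

Lemma coef_cvg g m : (forall u, normc u = 1 -> derivable g u 1) ->
  (fun n => avg n (fun u => g u * u^-1 ^+ m)) @ \oo --> coef g m.
Proof.
move=> gd; apply: avg_cvg; apply: unif_circle_continuous => u u1.
by apply/derivable_continuousC/derivable_mulXV; rewrite ?normc1_neq0 //; exact: gd.
Qed.

Lemma cvgC_lim (a : nat -> R[i]) (l : R[i]) : a @ \oo --> l -> limn a = l.
Proof. by move=> al; apply: cvg_lim al; exact: norm_hausdorff. Qed.

(* Let the radius of the inner circle in avg_annulus tend to 0. *)
Lemma avg_disc h : (forall z, normc z <= 1 -> derivable h z 1) ->
  (fun n => avg n h) @ \oo --> h 0.
Proof.
move=> hd; apply/cvgCP => e e0; have e20 : 0 < e / 2 by lra.
have h0 : derivable h 0 1 by apply: hd; rewrite normc0E.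
have [d d0 hd0] := continuousC_near (derivable_continuousC h0) e20.
pose r := Num.min (d / 2) 1.
have r0 : 0 < r by rewrite lt_min ltr01 andbT; lra.
have rE : normc r%:C%C = r by rewrite normcr gtr0_norm.
have rho0 : r%:C%C != 0 :> R[i] by rewrite -normc_gt0 rE.
have rho1 : normc r%:C%C <= 1 by rewrite rE ge_min lexx orbT.
have /cvgCP/(_ _ e20)[N hN] : (fun n => avg n (fun u => h (r%:C%C * u)) - avg n h)
    @ \oo --> (0 : R[i]).
  by apply: (avg_annulus rho0 rho1) => z /andP[_]; exact: hd.
exists N => n /hN; rewrite subr0 normcBC => hn.
rewrite (le_lt_trans (ler_normc_dist _ (avg n (fun u => h (r%:C%C * u))) _)) //.
have : normc (avg n (fun u => h (r%:C%C * u)) - h 0) <= e / 2.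
  rewrite -[h 0](avg_cst n) avgB; apply: avg_le => u u1.
  rewrite normcBC ltW //; apply: hd0; apply/ballCE.
  rewrite sub0r normcNE normcM u1 rE mulr1.
  by rewrite (@le_lt_trans _ _ (d / 2)) ?ge_min ?lexx //; lra.
lra.
Qed.

(** Coefficients of negative index vanish: [g u * u ^+ l] is differentiable on the disc and zero at
    its centre. *)
Lemma avg_mulX g l : (forall z, normc z <= 1 -> derivable g z 1) -> (0 < l)%N ->
  (fun n => avg n (fun u => g u * u ^+ l)) @ \oo --> (0 : R[i]).
Proof.
move=> gd l0; have := @avg_disc (fun u => g u * u ^+ l).
rewrite expr0n eqn0Ngt l0 mulr0; apply => z z1.
by apply: derivable_mulX; exact: gd.
Qed.

Lemma coef0 g : (forall z, normc z <= 1 -> derivable g z 1) -> coef g 0 = g 0.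
Proof.
move=> gd; apply: cvgC_lim; rewrite (_ : (fun _ => _) = fun n => avg n g).
  exact: avg_disc.
by apply/funext => n; apply: eq_avg => u _; rewrite mulr1.
Qed.

Lemma coef_cst (a : R[i]) m : coef (fun=> a) m = a * (m == 0%N)%:R.
Proof.
apply: cvgC_lim; apply/cvgCP => e e0; exists m => n mn.
rewrite avgZ (@eq_avg _ _ _ (fun u => u ^+ 0 * u^-1 ^+ m)) => [|u _]; last first.
  by rewrite mul1r.
rewrite avg_ortho ?expn_gt0 // 1?eq_sym ?subrr ?normc0E //.
exact: leq_trans (ltn_expl m (ltnSn 1)) (leq_pexp2l _ mn).
Qed.

(** For t != 0, [avg_annulus] equates the limiting means of g(u) u^-m over the circles of radius |t|
    and 1. That function may be singular at 0, so t = 0 is treated apart. *)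
Lemma coef_scale g t m : (forall z, normc z <= 1 -> derivable g z 1) ->
  normc t <= 1 -> coef (fun u => g (t * u)) m = t ^+ m * coef g m.
Proof.
move=> gd t1; have [->|t0] := eqVneq t 0.
  rewrite (_ : (fun u => _) = fun=> g 0); last by apply/funext => u; rewrite mul0r.
  rewrite coef_cst expr0n; case: eqP => [->|_]; last by rewrite mulr0 mul0r.
  by rewrite coef0 // mulr1 mul1r.
pose h u := g u * u^-1 ^+ m.
have h_cvg : (fun n => avg n h) @ \oo --> coef g m.
  by apply: coef_cvg => u u1; apply: gd; rewrite u1.
have ht_cvg : (fun n => avg n (fun u => h (t * u)) - avg n h) @ \oo --> (0 : R[i]).
  apply: (avg_annulus t0 t1) => z /andP[tz z1]; apply: derivable_mulXV; last exact: gd.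
  by rewrite -normc_gt0 (lt_le_trans _ tz) // normc_gt0.
apply: cvgC_lim.
have lim_ht : (fun n => t ^+ m * avg n (fun u => h (t * u))) @ \oo --> t ^+ m * coef g m.
  apply: cvgCMl; rewrite -[coef g m]addr0.
  rewrite (_ : (fun n => _) = fun n =>
    avg n h + (avg n (fun u => h (t * u)) - avg n h)); first exact: (cvgD h_cvg ht_cvg).
  by apply/funext => n; rewrite addrC subrK.
rewrite (_ : (fun n => _) = fun n => t ^+ m * avg n (fun u => h (t * u))) //.
apply/funext => n; rewrite -avgZ; apply: eq_avg => u u1.
rewrite /h invfM exprMn [RHS]mulrCA; congr (_ * _).
by rewrite mulrA [t^-1 ^+ m]exprVn mulfV ?mul1r // expf_neq0.
Qed.

(** The inner sum is the partial sum of [c] up to index [l], listed backwards; indexing by pairs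
    matches the double sum in [fejer]. *)
Definition cesaro_sum K (c : nat -> R[i]) : R[i] :=
  K%:R^-1 * \sum_(l < K) \sum_(k < K | (k <= l)%N) c (l - k)%N.

(** The Fejer kernel on the unit circle, expanded so that orthogonality applies term by term;
    [fejerE] gives its square form. *)
Definition fejer K u : R[i] :=
  K%:R^-1 * \sum_(l < K) \sum_(k < K) u ^+ k * u^-1 ^+ l.

(** A pair k <= l contributes the coefficient of index l - k; a pair k > l contributes one of
    negative index, which vanishes. *)
Lemma fejer_cvg g K : (forall z, normc z <= 1 -> derivable g z 1) ->
  (fun n => avg n (fun u => g u * fejer K u)) @ \oo --> cesaro_sum K (coef g).
Proof.
move=> gd; have gd1 u : normc u = 1 -> derivable g u 1 by move=> u1; apply: gd; rewrite u1.
rewrite (_ : (fun n => _) = fun n => K%:R^-1 *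
    \sum_(l < K) \sum_(k < K) avg n (fun u => g u * (u ^+ k * u^-1 ^+ l))).
  apply: cvgCMl; apply: cvgC_sum => l; rewrite [X in _ --> X]big_mkcond /=.
  apply: cvgC_sum => k; case: leqP => [kl|lk].
    rewrite (_ : (fun n => _) = fun n => avg n (fun u => g u * u^-1 ^+ (l - k))).
      exact: coef_cvg.
    apply/funext => n; apply: eq_avg => u /normc1_neq0 u0; congr (_ * _).
    by rewrite -{1}(subnKC kl) exprD mulrA !exprVn mulfV ?mul1r // expf_neq0.
  rewrite (_ : (fun n => _) = fun n => avg n (fun u => g u * u ^+ (k - l))).
    by apply: (avg_mulX gd); rewrite subn_gt0.
  apply/funext => n; apply: eq_avg => u /normc1_neq0 u0; congr (_ * _).
  by rewrite -{1}(subnK (ltnW lk)) exprD -mulrA !exprVn mulfV ?mulr1 // expf_neq0.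
apply/funext => n; rewrite (eq_bigr (fun l : 'I_K => avg n (fun u => g u *
    \sum_(k < K) u ^+ k * u^-1 ^+ l))) => [|l _].
  rewrite -avg_sum -avgZ; apply: eq_avg => u _.
  by rewrite -mulr_sumr mulrCA.
by rewrite -avg_sum; apply: eq_avg => u _; rewrite mulr_sumr.
Qed.

Lemma avg_fejer n K : (0 < K)%N -> (K <= 2 ^ n)%N -> avg n (fejer K) = 1.
Proof.
move=> K0 Kn; have ltn (l : 'I_K) : (l < 2 ^ n)%N by rewrite (leq_trans (ltn_ord l)).
rewrite avgZ avg_sum (eq_bigr (fun=> 1)) => [|l _].
  by rewrite sumr_const card_ord mulVf // pnatr_eq0 -lt0n.
rewrite avg_sum (bigD1 l) //= big1 => [|k kl].
  by rewrite avg_ortho // eqxx addr0.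
by rewrite avg_ortho // val_eqE (negPf kl).
Qed.

Lemma fejerE K u : normc u = 1 -> fejer K u = K%:R^-1 * `|\sum_(k < K) u ^+ k| ^+ 2.
Proof.
move=> u1; rewrite sqr_normc rmorph_sum /=; congr (_ * _).
have uV : u^-1 = conjc u by rewrite invc_norm normrC u1 expr1n invr1 mul1r.
rewrite exchange_big mulr_suml; apply: eq_bigr => k _ /=.
by rewrite -mulr_sumr; congr (_ * _); apply: eq_bigr => l _; rewrite uV rmorphXn.
Qed.

Lemma fejer_ge0 K u : normc u = 1 -> 0 <= fejer K u.
Proof. by move=> /fejerE->; rewrite mulr_ge0 // exprn_ge0. Qed.

(** The geometric sum satisfies |u - 1| |sum of u^k| = |u^K - 1| <= 2. *)
Lemma fejer_le K u (d : R) : normc u = 1 -> 0 < d -> d <= normc (u - 1) ->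
  fejer K u <= (4 / (K%:R * d ^+ 2))%:C%C.
Proof.
move=> u1 d0 du; rewrite fejerE //.
have D2 : normc (\sum_(k < K) u ^+ k) <= 2 / d.
  rewrite ler_pdivlMr // mulrC (@le_trans _ _ (normc (u ^+ K - 1))) //.
    by rewrite subrX1 normcM ler_wpM2r ?normc_ge0.
  by rewrite (le_trans (ler_normcB _ _)) // normcX u1 expr1n normc1E.
have -> : K%:R^-1 * `|\sum_(k < K) u ^+ k| ^+ 2 =
    (K%:R^-1 * normc (\sum_(k < K) u ^+ k) ^+ 2)%:C%C.
  by rewrite normrC rmorphM rmorphXn fmorphV rmorph_nat.
have -> : 4 / (K%:R * d ^+ 2) = K%:R^-1 * (2 / d) ^+ 2.
  by rewrite invfM expr_div_n -natrX mulrCA.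
rewrite lecR ler_wpM2l ?invr_ge0 //.
by rewrite ler_pXn2r ?nnegrE ?normc_ge0 // divr_ge0 // ltW.
Qed.

(** The kernel is nonnegative with mean 1. Nodes within [d] of 1 contribute at most [e]; at the
    others |g u - g 1| <= 2S and the kernel is at most 4/(K d^2). *)
Lemma cesaro_dist g (S d e : R) K : (forall z, normc z <= 1 -> derivable g z 1) ->
  (0 < K)%N -> 0 < d -> 0 <= e ->
  (forall u, normc u = 1 -> normc (g u) <= S) ->
  (forall u, normc u = 1 -> normc (u - 1) < d -> normc (g u - g 1) <= e) ->
  normc (cesaro_sum K (coef g) - g 1) <= e + 8 * S / (K%:R * d ^+ 2).
Proof.
move=> gd K0 d0 e0 gS ge.
apply: (cvgC_le (N := K) (fejer_cvg gd)) => n Kn.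
(* Having at least [K] nodes makes the discrete mean of the kernel exactly 1. *)
have Kn2 : (K <= 2 ^ n)%N by rewrite (leq_trans Kn) // ltnW // ltn_expl.
set B := 8 * S / _.
have -> : avg n (fun u => g u * fejer K u) - g 1 =
    avg n (fun u => (g u - g 1) * fejer K u).
  have g1E : g 1 = avg n (fun u => g 1 * fejer K u) by rewrite avgZ avg_fejer // mulr1.
  by rewrite [X in _ - X = _]g1E avgB; apply: eq_avg => u _; rewrite mulrBl.
suff : `|avg n (fun u => (g u - g 1) * fejer K u)| <=
    avg n (fun u => e%:C%C * fejer K u + B%:C%C).
  have -> : avg n (fun u => e%:C%C * fejer K u + B%:C%C) = (e + B)%:C%C.
    rewrite {1}/avg big_split /= mulrDr -/(avg n (fun=> B%:C%C)) avg_cst.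
    by rewrite -/(avg n (fun u => e%:C%C * fejer K u)) avgZ avg_fejer // mulr1 rmorphD.
  by rewrite normrC lecR.
rewrite /avg normrM ger0_norm ?invr_ge0 ?exprn_ge0 //.
rewrite ler_wpM2l ?invr_ge0 ?exprn_ge0 //.
apply: le_trans (ler_norm_sum _ _ _) _; apply: ler_sum => j _.
have := normc_zetaX R n j; move: (zeta R n ^+ j) => u u1.
have S0 : 0 <= S by apply: le_trans (gS u u1); exact: normc_ge0.
have B0 : 0 <= B by rewrite divr_ge0 ?mulr_ge0 ?(ltW d0).
have F0 := fejer_ge0 K u1; rewrite normrM [`|fejer K u|]ger0_norm // normrC.
have [ud|du] := ltP (normc (u - 1)) d.
  by rewrite -[leLHS]addr0 lerD ?ler0c // ler_wpM2r // lecR ge.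
rewrite -[leLHS]add0r; apply: lerD; first by apply: mulr_ge0 F0; rewrite ler0c.
have -> : B = 2 * S * (4 / (K%:R * d ^+ 2)) by rewrite /B; ring.
rewrite [leRHS]rmorphM ler_pM ?ler0c ?normc_ge0 //; last exact: fejer_le.
by rewrite lecR (le_trans (ler_normcB _ _)) // mulr2n mulrDl mul1r lerD // gS ?normc1E.
Qed.

End Coefficients.

(** * Functions of two variables and their diagonals *)

Section TwoVariables.
Variables (R : realType) (F : R[i] -> R[i] -> R[i]).
Implicit Types (u v s t : R[i]).
Hypothesis F_dr : forall u t, normc u = 1 -> normc t <= 1 -> derivable (F u) t 1.
Hypothesis F_dl : forall s v, normc s <= 1 -> normc v = 1 -> derivable (F ^~ v) s 1.
Hypothesis F_cont : forall u t, normc u = 1 -> normc t <= 1 ->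
  {for (u, t), continuous (fun p : R[i] * R[i] => F p.1 p.2)}.

Let T := [set z : R[i] | normc z = 1].
Let D := [set z : R[i] | normc z <= 1].

(** Uniform continuity of F(u,v) v^-m on the torus makes the number of nodes independent of [u]. *)
Lemma coef_avg_unif m (e : R) : 0 < e -> exists M, forall u, normc u = 1 ->
  normc (coef (F u) m - avg M (fun v => F u v * v^-1 ^+ m)) <= e.
Proof.
move=> e0; have [C C0 hC] := zeta_bound R.
have cont p : (T `*` T) p ->
    {for p, continuous (fun p : R[i] * R[i] => F p.1 p.2 * p.2^-1 ^+ m)}.
  case: p => u v [/= u1 v1]; apply: continuousM.
    by apply: F_cont; rewrite // v1.
  apply: (@continuous_comp _ _ _ snd (fun w : R[i] => w^-1 ^+ m)).
    exact: cvg_snd.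
  rewrite (_ : (fun w => _) = fun w => 1 * w^-1 ^+ m); last first.
    by apply/funext => w; rewrite mul1r.
  apply: derivable_continuousC.
  exact: (derivable_mulXV (normc1_neq0 v1) (@derivable_cstC R 1 v)).
have [d d0 hd] := compact_unif_continuous
  (compact_setX (@compact_circle R) (@compact_circle R)) cont e0.
have [M hM] := exists_pow2_lt C0 d0.
exists M => u u1.
have Fu_cvg : (fun n => avg n (fun v => F u v * v^-1 ^+ m)) @ \oo --> coef (F u) m.
  by apply: coef_cvg => v v1; apply: F_dr; rewrite // v1.
apply: (cvgC_le (N := M) Fu_cvg) => n Mn; rewrite -(subnKC Mn).
apply: (avg_refine _ hC _ hM) => v v' v1 v'1 vv'; apply/ltW.
apply: (hd (u, v) (u, v')) => //; split => /=; last exact/ballCE.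
by apply: ballxx; rewrite ltcR.
Qed.

(** Replacing [coef (F u) m] by a finite mean costs at most e/2, uniformly in [u]. The two averages
    are then exchanged, and for each node [v] the positive power of [u] makes the limit vanish by
    [avg_mulX]. *)
Lemma avg_mulX_coef m l : (0 < l)%N ->
  (fun n => avg n (fun u => coef (F u) m * u ^+ l)) @ \oo --> (0 : R[i]).
Proof.
move=> l0; apply/cvgCP => e e0; have e20 : 0 < e / 2 by lra.
have [M hM] := coef_avg_unif m e20.
pose a n := avg n (fun u => avg M (fun v => F u v * v^-1 ^+ m) * u ^+ l).
have /cvgCP/(_ _ e20)[N hN] : a @ \oo --> (0 : R[i]).
  rewrite (_ : a = fun n => (2 ^+ M)^-1 * \sum_(0 <= j < 2 ^ M)
      (zeta R M ^+ j)^-1 ^+ m * avg n (fun u => F u (zeta R M ^+ j) * u ^+ l)).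
    rewrite -[X in _ --> X](mulr0 (2 ^+ M)^-1).
    apply: cvgCMl; rewrite [X in _ --> X](_ : 0 =
      \sum_(0 <= j < 2 ^ M) (zeta R M ^+ j)^-1 ^+ m * 0); last first.
      by rewrite big1 // => j _; rewrite mulr0.
    apply: cvgC_sum => j; apply: cvgCMl; apply: (avg_mulX (g := F ^~ _)) => // s s1.
    exact: (F_dl s1 (normc_zetaX R M j)).
  apply/funext => n; rewrite /a.
  rewrite (eq_avg n (psi := fun u => avg M (fun v => v^-1 ^+ m * (F u v * u ^+ l)))).
    rewrite avg_exchange; congr (_ * _); apply: eq_bigr => j _.
    by rewrite -avgZ.
  by move=> u _; rewrite mulrC -avgZ; apply: eq_avg => v _; rewrite mulrC -mulrA mulrCA.
exists N => n /hN; rewrite !subr0 => an.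
rewrite -[avg _ _](subrK (a n)) (le_lt_trans (ler_normcD _ _)) //.
have : normc (avg n (fun u => coef (F u) m * u ^+ l) - a n) <= e / 2.
  rewrite avgB; apply: avg_le => u u1.
  by rewrite -mulrBl normcM normcX u1 expr1n mulr1 hM.
lra.
Qed.

(** [cesaro_dist] is applied to v -> F u (t v) at v = 1; compactness of circle times disc makes the
    bound [S] and the radius [d] uniform in u and t. *)
Lemma cesaro_unif (e : R) : 0 < e -> exists2 K, (0 < K)%N &
  forall u t, normc u = 1 -> normc t <= 1 ->
    normc (cesaro_sum K (fun m => t ^+ m * coef (F u) m) - F u t) <= e.
Proof.
move=> e0; have e20 : 0 < e / 2 by lra.
have cont p : (T `*` D) p -> {for p, continuous (fun p : R[i] * R[i] => F p.1 p.2)}.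
  by case: p => u t [/= u1 t1]; exact: F_cont.
have cTD := compact_setX (@compact_circle R) (@compact_disc R).
have [S S0 hS] := compact_normc_bounded cTD cont.
have [d d0 hd] := compact_unif_continuous cTD cont e20.
have d20 : 0 < d ^+ 2 by rewrite exprn_gt0.
have w0 : 0 < d ^+ 2 * (e / 2) by rewrite mulr_gt0.
(* K >= x amounts to 8S/(K d^2) <= e/2; the successor makes [K] positive. *)
pose x := 8 * S / (d ^+ 2 * (e / 2)); pose K := (Num.bound x).+1.
have hK : 8 * S / (K%:R * d ^+ 2) <= e / 2.
  have xK : x <= K%:R.
    rewrite (@le_trans _ _ (Num.bound x)%:R) ?ler_nat //; apply/ltW/archi_boundP.
    by rewrite divr_ge0 ?mulr_ge0 // ltW.
  rewrite ler_pdivrMr ?mulr_gt0 // mulrCA.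
  by rewrite [e / 2 * _]mulrC -ler_pdivrMr.
exists K => // u t u1 t1.
have scaled v : normc v <= 1 -> normc (t * v) <= 1.
  by move=> v1; rewrite normcM mulr_ile1 ?normc_ge0.
have -> : cesaro_sum K (fun m => t ^+ m * coef (F u) m) =
    cesaro_sum K (coef (fun v => F u (t * v))).
  congr (_ * _); apply: eq_bigr => l _; apply: eq_bigr => k _.
  by rewrite coef_scale // => z z1; exact: F_dr.
rewrite -[X in F u X]mulr1.
have := @cesaro_dist R (fun v => F u (t * v)) S d (e / 2) K _ (ltn0Sn _) d0 (ltW e20) _ _.
move=> /(_ _ _ _)/le_trans; apply; last lra.
- by move=> z z1; apply: derivable_scale; apply: F_dr => //; exact: scaled.
- by move=> v v1; apply: (hS (u, t * v)); split => //=; apply: scaled; rewrite v1.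
- move=> v v1 v1d; rewrite mulr1 normcBC ltW //.
  apply: (hd (u, t) (u, t * v)) => //; split => /=; first by apply: ballxx; rewrite ltcR.
  apply/ballCE; rewrite -{1}[t]mulr1 -mulrBr normcM normcBC.
  by rewrite (le_lt_trans _ v1d) // -[leRHS]mul1r ler_wpM2r ?normc_ge0.
Qed.

(* The part of degree k of t |-> F t (t * lambda) is a polynomial of degree at
   most k in lambda, hence is killed by every functional which kills the powers
   of lambda up to the k-th. *)
Lemma diagonal_coef_vanish N (b lambda : 'I_N -> R[i]) k :
  (forall i, normc (lambda i) <= 1) ->
  (forall m, (m <= k)%N -> \sum_i b i * lambda i ^+ m = 0) ->
  (fun n => avg n (fun u => (\sum_i b i * F u (u * lambda i)) * u^-1 ^+ k))
    @ \oo --> (0 : R[i]).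
Proof.
(* The added 1 allows division by [B]; with tolerance e/2/B at each point, the errors weighted by
   [b] sum to at most e/2. *)
move=> l1 bl0; apply/cvgCP => e e0; pose B := 1 + \sum_i normc (b i).
have B0 : 0 < B by rewrite ltr_pwDl // sumr_ge0 // => i _; exact: normc_ge0.
have eB0 : 0 < e / 2 / B by rewrite divr_gt0 //; lra.
have [K K0 hK] := cesaro_unif eB0.
pose beta m := \sum_i b i * lambda i ^+ m.
pose a n := avg n (fun u => cesaro_sum K (fun m => beta m * (coef (F u) m * u ^+ m)) * u^-1 ^+ k).
have e20 : 0 < e / 2 by lra.
have /cvgCP/(_ _ e20)[M hM] : a @ \oo --> (0 : R[i]).
  rewrite (_ : a = fun n => K%:R^-1 * \sum_(l < K) \sum_(j < K | (j <= l)%N)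
      beta (l - j)%N * avg n (fun u => coef (F u) (l - j)%N * (u ^+ (l - j) * u^-1 ^+ k))).
    rewrite -[X in _ --> X](mulr0 K%:R^-1).
    apply: cvgCMl; rewrite [X in _ --> X](_ : 0 = \sum_(l < K) \sum_(j < K) 0); last first.
      by rewrite big1 // => j _; rewrite big1.
    apply: cvgC_sum => l; under eq_fun => n do rewrite big_mkcond.
    apply: cvgC_sum => j; case: (j <= l)%N; last exact: cvg_cst.
    (* Degrees up to [k] are annihilated by [b]; a higher degree leaves a positive power of [u],
       whose means tend to 0. *)
    have [lk|kl] := leqP (l - j) k.
      rewrite (_ : (fun n => _) = fun=> 0); first exact: cvg_cst.
      by apply/funext => n; rewrite /beta bl0 // mul0r.
    rewrite -[X in _ --> X](mulr0 (beta (l - j)%N)); apply: cvgCMl.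
    rewrite (_ : (fun n => _) = fun n => avg n (fun u => coef (F u) (l - j) * u ^+ (l - j - k))).
      by apply: avg_mulX_coef; rewrite subn_gt0.
    apply/funext => n; apply: eq_avg => u /normc1_neq0 u0; congr (_ * _).
    by rewrite -{1}(subnK (ltnW kl)) exprD -mulrA !exprVn mulfV ?mulr1 // expf_neq0.
  apply/funext => n; rewrite /a /cesaro_sum.
  rewrite (eq_bigr (fun l : 'I_K => avg n (fun u => \sum_(j < K | (j <= l)%N)
      beta (l - j)%N * (coef (F u) (l - j)%N * (u ^+ (l - j) * u^-1 ^+ k))))) => [|l _].
    rewrite -avg_sum -avgZ; apply: eq_avg => u _; rewrite -mulrA mulr_suml.
    congr (_ * _); apply: eq_bigr => l _; rewrite mulr_suml.
    by apply: eq_bigr => j _; rewrite !mulrA.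
  by rewrite avg_sum; apply: eq_bigr => j _; rewrite avgZ.
exists M => n /hM; rewrite !subr0 => an.
rewrite -[avg _ _](subrK (a n)) (le_lt_trans (ler_normcD _ _)) //.
suff : normc (avg n (fun u => (\sum_i b i * F u (u * lambda i)) * u^-1 ^+ k) - a n) <= e / 2.
  lra.
rewrite avgB; apply: avg_le => u u1.
rewrite -mulrBl normcM normcXV u1 invr1 expr1n mulr1.
have -> : cesaro_sum K (fun m => beta m * (coef (F u) m * u ^+ m)) =
    \sum_i b i * cesaro_sum K (fun m => (u * lambda i) ^+ m * coef (F u) m).
  rewrite (eq_bigr (fun i => K%:R^-1 * (b i * \sum_(l < K) \sum_(j < K | (j <= l)%N)
      ((u * lambda i) ^+ (l - j) * coef (F u) (l - j))))) => [|i _]; last first.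
    by rewrite mulrCA.
  rewrite -mulr_sumr; congr (_ * _).
  under [RHS]eq_bigr do rewrite mulr_sumr.
  rewrite exchange_big; apply: eq_bigr => l _.
  under [RHS]eq_bigr do rewrite mulr_sumr.
  rewrite exchange_big; apply: eq_bigr => j _ /=.
  rewrite mulr_suml; apply: eq_bigr => i _; rewrite exprMn; ring.
rewrite -sumrB (le_trans (ler_normc_sum _ _ _)) //.
apply: (@le_trans _ _ (\sum_i normc (b i) * (e / 2 / B))).
  apply: ler_sum => i _; rewrite -mulrBr normcM ler_wpM2l ?normc_ge0 // normcBC.
  by apply: hK => //; rewrite normcM u1 mul1r.
rewrite -mulr_suml mulrA ler_pdivrMr // mulrC ler_wpM2l ?(ltW e20) //.
by rewrite lerDr.
Qed.

End TwoVariables.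

(** * Slices, polynomial functions and measurability *)

Section Slices.
Variables (R : realType) (n : nat).
Local Notation V := 'rV[R[i]]_n.
Implicit Types (f : V -> R[i]) (a x w z : V).

Lemma differentiable_line a w (s : R[i]) :
  differentiable (fun s : R[i] => a + s *: w) s.
Proof.
apply: differentiableD; first exact: differentiable_cst.
apply: differentiableZl; exact: ex_diff.
Qed.

Lemma derivable_slice f a w (s : R[i]) : differentiable f (a + s *: w) ->
  derivable (fun s : R[i] => f (a + s *: w)) s 1.
Proof.
move=> fd; apply/derivable1_diffP; apply: differentiable_comp.
  exact: differentiable_line.
exact: fd.
Qed.

Lemma derivable_ray f z (s : R[i]) : differentiable f (s *: z) ->
  derivable (fun s : R[i] => f (s *: z)) s 1.
Proof.
rewrite -[s *: z]add0r => /derivable_slice.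
by rewrite (_ : (fun s : R[i] => f (0 + s *: z)) = fun s => f (s *: z)) //; apply/funext => t;
  rewrite add0r.
Qed.

Lemma continuous_scale_pair f (s : R[i]) z : differentiable f (s *: z) ->
  {for (s, z), continuous (fun p : R[i] * V => f (p.1 *: p.2))}.
Proof.
move=> fd; apply: (@continuous_comp _ _ _ (fun p : R[i] * V => p.1 *: p.2) f).
  exact: scale_continuous.
exact: differentiable_continuous.
Qed.

Lemma continuous_plane f a w (s t : R[i]) : differentiable f (s *: a + t *: w) ->
  {for (s, t), continuous (fun p : R[i] * R[i] => f (p.1 *: a + p.2 *: w))}.
Proof.
move=> fd; apply: (@continuous_comp _ _ _ (fun p : R[i] * R[i] => p.1 *: a + p.2 *: w) f).
  by apply: cvgD; apply: cvgZr_tmp; [exact: cvg_fst|exact: cvg_snd].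
exact: differentiable_continuous.
Qed.

Lemma open0_ball (U : set V) : open U -> U 0 ->
  exists2 r : R, 0 < r & forall x, `|x| < r%:C%C -> U x.
Proof.
move=> oU U0; have [r r0 hr] := near_ballC (open_nbhs_nbhs (conj oU U0)).
by exists r => // x xr; apply: hr; rewrite -ball_normE /= sub0r normrN.
Qed.

Lemma normv_real (x : V) : exists2 m : R, 0 <= m & `|x| = m%:C%C.
Proof.
exists (complex.Re `|x|); last by rewrite RRe_real // ger0_real.
by rewrite -ler0c RRe_real // ger0_real.
Qed.

End Slices.

Section PolynomialFunctions.
Variables (R : realType) (n : nat).
Local Notation V := 'rV[R[i]]_n.
Implicit Types (g h : V -> R[i]).

Lemma polynomial_fun_cst (c : R[i]) : @polynomial_fun R n (fun=> c).
Proof.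
exists [:: (c, fun=> 0%N)] => z; by rewrite big_seq1 big1 ?mulr1.
Qed.

Lemma polynomial_funD g h : polynomial_fun g -> polynomial_fun h ->
  polynomial_fun (fun z => g z + h z).
Proof.
by move=> [s gs] [t ht]; exists (s ++ t) => z; rewrite big_cat gs ht.
Qed.

Lemma polynomial_funZ (c : R[i]) g : polynomial_fun g ->
  polynomial_fun (fun z => c * g z).
Proof.
move=> [s gs]; exists [seq (c * m.1, m.2) | m <- s] => z.
by rewrite gs mulr_sumr big_map; apply: eq_bigr => m _; rewrite mulrA.
Qed.

Lemma polynomial_fun_mulX (j : 'I_n) l g : polynomial_fun g ->
  polynomial_fun (fun z => z 0 j ^+ l * g z).
Proof.
move=> [s gs].
exists [seq (m.1, fun i => (m.2 i + (i == j) * l)%N) | m <- s] => z.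
rewrite gs mulr_sumr big_map; apply: eq_bigr => m _ /=.
rewrite mulrCA; congr (_ * _).
under [RHS]eq_bigr do rewrite exprD.
rewrite big_split /= mulrC; congr (_ * _).
rewrite (bigD1 j) //= eqxx mul1n big1 ?mulr1 // => i /negPf->.
by rewrite mul0n expr0.
Qed.

Lemma polynomial_fun_sum (I : Type) (r : seq I) (P : pred I) (G : I -> V -> R[i]) :
  (forall i, polynomial_fun (G i)) ->
  polynomial_fun (fun z => \sum_(i <- r | P i) G i z).
Proof.
move=> hG; elim: r => [|i r IH].
  rewrite (_ : (fun _ => _) = fun=> 0); first exact: polynomial_fun_cst.
  by apply/funext => z; rewrite big_nil.
case Pi : (P i).
  rewrite (_ : (fun _ => _) = fun z => G i z + \sum_(i <- r | P i) G i z).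
    exact: polynomial_funD.
  by apply/funext => z; rewrite big_cons Pi.
by rewrite (_ : (fun _ => _) = fun z => \sum_(i <- r | P i) G i z) //;
  apply/funext => z; rewrite big_cons Pi.
Qed.

End PolynomialFunctions.

Section Measurability.
Context d (T : measurableType d) (R : realType).
Implicit Types (g h : T -> R[i]).

Lemma measurable_C_cst (c : R[i]) : measurable_C (fun _ : T => c).
Proof. by split; exact: measurable_cst. Qed.

Lemma measurable_CD g h : measurable_C g -> measurable_C h ->
  measurable_C (fun w => g w + h w).
Proof.
move=> [g1 g2] [h1 h2]; split.
  rewrite (_ : (fun w => _) = (fun w => complex.Re (g w)) \+ (fun w => complex.Re (h w))).
    exact: measurable_funD.
  by apply/funext => w /=; case: (g w) (h w) => [a b] [c e].
rewrite (_ : (fun w => _) = (fun w => complex.Im (g w)) \+ (fun w => complex.Im (h w))).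
  exact: measurable_funD.
by apply/funext => w /=; case: (g w) (h w) => [a b] [c e].
Qed.

Lemma measurable_CZ (c : R[i]) g : measurable_C g -> measurable_C (fun w => c * g w).
Proof.
case: c => a b [g1 g2].
have scale (r : R) (h : T -> R) : measurable_fun setT h ->
    measurable_fun setT (fun w : T => r * h w).
  by move=> mh; apply: measurable_funM => //; exact: measurable_cst.
split.
  rewrite (_ : (fun w => _) = (fun w => a * complex.Re (g w)) \- (fun w => b * complex.Im (g w))).
    by apply: measurable_funB; exact: scale.
  by apply/funext => w /=; case: (g w) => [e e'].
rewrite (_ : (fun w => _) = (fun w => a * complex.Im (g w)) \+ (fun w => b * complex.Re (g w))).
  by apply: measurable_funD; exact: scale.
by apply/funext => w /=; case: (g w) => [e e'].
Qed.

Lemma measurable_C_sum (I : Type) (r : seq I) (P : pred I) (G : I -> T -> R[i]) :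
  (forall i, measurable_C (G i)) ->
  measurable_C (fun w => \sum_(i <- r | P i) G i w).
Proof.
move=> hG; elim: r => [|i r IH].
  rewrite (_ : (fun _ => _) = fun=> 0); first exact: measurable_C_cst.
  by apply/funext => z; rewrite big_nil.
case Pi : (P i).
  rewrite (_ : (fun _ => _) = fun z => G i z + \sum_(i <- r | P i) G i z).
    exact: measurable_CD.
  by apply/funext => z; rewrite big_cons Pi.
by rewrite (_ : (fun _ => _) = fun z => \sum_(i <- r | P i) G i z) //;
  apply/funext => z; rewrite big_cons Pi.
Qed.

Lemma measurable_C_cvg (G : nat -> T -> R[i]) h : (forall m, measurable_C (G m)) ->
  (forall w, (fun m => G m w) @ \oo --> h w) -> measurable_C h.
Proof.
move=> mG Gh; split.
  apply: (measurable_fun_cvg (h := fun m w => complex.Re (G m w))).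
    by move=> m; have [] := mG m.
  by move=> w _; exact: cvgC_Re.
apply: (measurable_fun_cvg (h := fun m w => complex.Im (G m w))).
  by move=> m; have [] := mG m.
by move=> w _; exact: cvgC_Im.
Qed.

End Measurability.

(** * Homogeneous parts *)

Section Homogeneous.
Variables (R : realType) (n : nat) (U : set 'rV[R[i]]_n).
Local Notation V := 'rV[R[i]]_n.
Implicit Types (f : V -> R[i]) (z : V) (s t u v : R[i]).
Hypotheses (oU : open U) (bU : balanced U) (U0 : U 0).

(** [U] contains a ball of radius r around 0, and t = r / (|a| + |w| + 1) sends the whole bidisc
    into it. *)
Lemma absorbing_plane (a w : V) : exists2 t : R[i], t != 0 &
  forall s s', normc s <= 1 -> normc s' <= 1 -> U (s *: (t *: a) + s' *: (t *: w)).
Proof.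
have [r r0 hr] := open0_ball oU U0.
have [ma ma0 aE] := normv_real a; have [mw mw0 wE] := normv_real w.
have m0 : 0 < ma + mw + 1 by lra.
pose q := r / (ma + mw + 1); have q0 : 0 < q by rewrite divr_gt0.
have qE : normc q%:C%C = q by rewrite normcr gtr0_norm.
exists q%:C%C; first by rewrite -normc_gt0 qE.
move=> s s' s1 s'1; apply: hr; apply: le_lt_trans (ler_normD _ _) _.
rewrite !normrZ aE wE !normrC qE -!rmorphM -rmorphD ltcR.
rewrite (@le_lt_trans _ _ (q * (ma + mw))) //.
  by rewrite mulrDr lerD // -[leRHS]mul1r ler_wpM2r // mulr_ge0 // ltW.
by rewrite /q mulrAC ltr_pdivrMr // ltr_pM2l //; lra.
Qed.

Lemma balancedZ z s : U z -> normc s <= 1 -> U (s *: z).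
Proof. by move=> Uz s1; apply: bU => //; rewrite normrC -[1]/(1%:C%C) lecR. Qed.

(** The factor depends on [U] and [z] only, not on the function, hence is constant in the random
    parameter when measurability is proved. *)
Definition into_dom z : R[i] := xget 1 [set t : R[i] | t != 0 /\ U (t *: z)].

Lemma into_domP z : into_dom z != 0 /\ U (into_dom z *: z).
Proof.
apply: (@xgetPex _ 1 [set t : R[i] | t != 0 /\ U (t *: z)]).
have [t t0 ht] := absorbing_plane z 0; exists t; split => //.
have := ht 1 0; rewrite scale1r scale0r addr0; apply; rewrite ?normc1E //.
by rewrite normc0E.
Qed.

(* The k-homogeneous part of f, defined outside U through a rescaling of z into U;
   by hom_partE the choice of the rescaling is immaterial. *)
Definition hom_part f k z : R[i] :=
  (into_dom z)^-1 ^+ k * coef (fun u => f (u *: (into_dom z *: z))) k.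

(** Of two rescalings, the one of smaller modulus is the other times a factor of modulus at most 1,
    and [coef_scale] applies to that ratio. *)
Lemma hom_partE f k z t : (forall z, U z -> differentiable f z) ->
  t != 0 -> U (t *: z) ->
  hom_part f k z = t^-1 ^+ k * coef (fun u => f (u *: (t *: z))) k.
Proof.
move=> fd; rewrite /hom_part.
have shrink s s' : s != 0 -> s' != 0 -> U (s' *: z) -> normc s <= normc s' ->
    s^-1 ^+ k * coef (fun u => f (u *: (s *: z))) k =
    s'^-1 ^+ k * coef (fun u => f (u *: (s' *: z))) k.
  move=> s0 s'0 Us' ss'.
  have := @coef_scale R (fun u => f (u *: (s' *: z))) (s / s') k.
  rewrite (_ : (fun u => f (s / s' * u *: (s' *: z))) = fun u => f (u *: (s *: z))).
    move=> ->; first by rewrite mulrA -exprMn mulKf.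
      by move=> u u1; apply: derivable_ray; apply: fd; exact: balancedZ.
    by rewrite normcM normcV ler_pdivrMr ?normc_gt0 // mul1r.
  by apply/funext => u; rewrite !scalerA mulrAC divfK // mulrC.
have [s0 Us] := into_domP z; move: (into_dom z) s0 Us => s s0 Us t0 Ut.
by have [st|/ltW ts] := leP (normc s) (normc t); [apply: shrink|rewrite -(shrink t s)].
Qed.

Definition upd z (j : 'I_n) v : V := \row_i (if i == j then v else z 0 i).

(** A polynomial of degree below 2^q has as m-th coefficient the mean of v^-m times its values at
    the 2^q-th roots of unity. The value at z_j minus the interpolant is a functional killing the
    powers up to [k], so [diagonal_coef_vanish] applies to it. *)
Lemma hom_part_interp f k q z (j : 'I_n) :
  (forall z, U z -> differentiable f z) -> (k < 2 ^ q)%N ->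
  hom_part f k z = \sum_(m < k.+1) z 0 j ^+ m *
    avg q (fun v => v^-1 ^+ m * hom_part f k (upd z j v)).
Proof.
move=> fd kq.
(* All nodes, the roots of unity and z_j, have modulus at most [r]; dividing by [r] puts them in the
   unit disc, and [w] carries the compensating factor. *)
pose r : R := 1 + normc (z 0 j).
have r0 : 0 < r by rewrite ltr_pwDl // normc_ge0.
have rC0 : r%:C%C != 0 :> R[i] by rewrite -normc_gt0 normcr normr_gt0 gt_eqF.
pose a := upd z j 0; pose w : V := r%:C%C *: delta_mx 0 j.
have updE v : upd z j v = a + (v / r%:C%C) *: w.
  apply/rowP => i; rewrite !mxE mulrA divfK //=.
  by case: (i == j); rewrite ?mulr1 ?add0r ?mulr0 ?addr0.
have [t t0 ht] := absorbing_plane a w.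
pose F s s' := f (s *: (t *: a) + s' *: (t *: w)).
have F_U s s' : normc s <= 1 -> normc s' <= 1 ->
    differentiable f (s *: (t *: a) + s' *: (t *: w)).
  by move=> s1 s'1; apply: fd; exact: ht.
(* Node 0 is z_j with weight 1; node i + 1 is the i-th power of [zeta R q], with minus its
   interpolation weight. *)
pose lam (i : nat) : R[i] := if i is i'.+1 then zeta R q ^+ i' else z 0 j.
pose b (i : nat) : R[i] := if i is i'.+1 then
  - ((2 ^+ q)^-1 * \sum_(m < k.+1) z 0 j ^+ m * (zeta R q ^+ i')^-1 ^+ m) else 1.
have bsum (G : R[i] -> R[i]) : \sum_(i < (2 ^ q).+1) b i * G (lam i) =
    G (z 0 j) - \sum_(m < k.+1) z 0 j ^+ m * avg q (fun v => v^-1 ^+ m * G v).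
  rewrite big_ord_recl /= mul1r; congr (_ + _).
  rewrite (eq_bigr (fun i : 'I_(2 ^ q) => - ((2 ^+ q)^-1 *
    \sum_(m < k.+1) z 0 j ^+ m * ((zeta R q ^+ i)^-1 ^+ m * G (zeta R q ^+ i))))).
    rewrite sumrN -mulr_sumr exchange_big /= mulr_sumr; congr (- _).
    apply: eq_bigr => m _; rewrite /avg big_mkord mulrCA; congr (_ * _).
    by rewrite mulr_sumr.
  move=> i _; rewrite mulNr -mulrA mulr_suml; congr (- (_ * _)).
  by apply: eq_bigr => m _; rewrite mulrA.
have lam_le i : normc (lam i / r%:C%C) <= 1.
  rewrite normcM normcV normcr gtr0_norm // ler_pdivrMr // mul1r /r.
  by case: i => [|i] /=; rewrite ?normc_zetaX ?lerDr // lerDl normc_ge0.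
have b_kill m : (m <= k)%N ->
    \sum_(i < (2 ^ q).+1) b i * (lam i / r%:C%C) ^+ m = 0.
  move=> mk; rewrite (eq_bigr (fun i : 'I_(2 ^ q).+1 =>
    b i * (lam i ^+ m) * r%:C%C^-1 ^+ m)) => [|i _]; last first.
    by rewrite exprMn mulrA.
  rewrite -mulr_suml (bsum (fun v => v ^+ m)).
  have mk1 : (m < k.+1)%N by [].
  rewrite (bigD1 (Ordinal mk1)) //= big1 => [|i im]; last first.
    rewrite (eq_avg q (psi := fun v => v ^+ m * v^-1 ^+ i)) => [|v _]; last exact: mulrC.
    rewrite avg_ortho; last 2 first.
    - exact: leq_ltn_trans mk kq.
    - exact: leq_ltn_trans (leq_ord i) kq.
    suff /negPf-> : m != i by rewrite mulr0.
    by apply: contraNneq im => mi; apply/eqP/val_inj.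
  rewrite (eq_avg q (psi := fun=> 1)) => [|v /normc1_neq0 v0]; last first.
    by rewrite exprVn mulVf // expf_neq0.
  by rewrite avg_cst mulr1 addr0 subrr mul0r.
have Fd : forall u v, normc u <= 1 -> normc v <= 1 ->
    derivable (F u) v 1 /\ derivable (F ^~ v) u 1.
  move=> u v u1 v1; split; first exact: derivable_slice (F_U u v u1 v1).
  rewrite (_ : F ^~ v = fun s => f (v *: (t *: w) + s *: (t *: a))).
    by apply: derivable_slice; rewrite addrC; exact: F_U.
  by apply/funext => s; rewrite /F addrC.
have := @diagonal_coef_vanish R F _ _ _ (2 ^ q).+1 b (fun i => lam i / r%:C%C) k _ b_kill.
(* With second argument u v / r, the plane function [F] becomes [f] on the ray through
   [t *: upd z j v], whose k-th coefficient is t^k times a value of the homogeneous part. *)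
have F_ray v u : F u (u * (v / r%:C%C)) = f (u *: (t *: upd z j v)).
  rewrite /F updE [t *: (_ + _)]scalerDr [u *: (_ + _)]scalerDr; congr (f (_ + _)).
  by rewrite !scalerA; congr (_ *: _); ring.
have Ut v : normc (v / r%:C%C) <= 1 -> U (t *: upd z j v).
  move=> v1; have := ht 1 (v / r%:C%C); rewrite normc1E => /(_ (lexx _) v1).
  by rewrite updE scale1r scalerDr !scalerA [t * _]mulrC.
move=> vanish.
have lim0 : (fun N => avg N (fun u => (\sum_(i < (2 ^ q).+1) b i * F u (u * (lam i / r%:C%C)))
    * u^-1 ^+ k)) @ \oo --> (0 : R[i]).
  apply: vanish.
  - by move=> u v u1 v1; have [] := Fd u v _ v1; rewrite ?u1.
  - by move=> u v u1 v1; have [] := Fd u v u1 _; rewrite ?v1.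
  - by move=> u v u1 v1; apply: continuous_plane; apply: F_U; rewrite ?u1.
  - by move=> i; exact: lam_le.
have homE (i : nat) : t ^+ k * hom_part f k (upd z j (lam i)) =
    coef (fun u => f (u *: (t *: upd z j (lam i)))) k.
  rewrite (hom_partE k fd t0 (Ut _ (lam_le i))) [LHS]mulrA -exprMn mulfV //.
  by rewrite expr1n mul1r.
have limS : (fun N => avg N (fun u => (\sum_(i < (2 ^ q).+1) b i * F u (u * (lam i / r%:C%C)))
    * u^-1 ^+ k)) @ \oo --> \sum_(i < (2 ^ q).+1) b i * (t ^+ k * hom_part f k (upd z j (lam i))).
  rewrite (_ : (fun N => _) = fun N => \sum_(i < (2 ^ q).+1)
      b i * avg N (fun u => f (u *: (t *: upd z j (lam i))) * u^-1 ^+ k)).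
    apply: cvgC_sum => i; apply: cvgCMl.
    rewrite homE.
    apply: coef_cvg => u u1; apply: derivable_ray; apply: fd.
    by apply: balancedZ (Ut _ (lam_le i)) _; rewrite u1.
  apply/funext => N; under [RHS]eq_bigr do rewrite -avgZ.
  rewrite -avg_sum; apply: eq_avg => u _; rewrite mulr_suml.
  by apply: eq_bigr => i _; rewrite F_ray mulrA.
(* The same means have two limits, which therefore agree; the nonzero factor [t ^+ k] is then
   cancelled. *)
have : \sum_(i < (2 ^ q).+1) b i * (t ^+ k * hom_part f k (upd z j (lam i))) = 0.
  by rewrite -(cvgC_lim limS) (cvgC_lim lim0).
rewrite (eq_bigr (fun i : 'I_(2 ^ q).+1 =>
  t ^+ k * (b i * hom_part f k (upd z j (lam i))))) => [|i _]; last by rewrite mulrCA.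
rewrite -mulr_sumr => /eqP; rewrite mulf_eq0 expf_eq0 (negPf t0) andbF /=.
rewrite (bsum (fun v => hom_part f k (upd z j v))) subr_eq0 => /eqP <-.
by congr hom_part; apply/rowP => i; rewrite !mxE; case: eqP => [->|].
Qed.

Definition mix l z (c : V) : V := \row_(i < n) (if (i < l)%N then z 0 i else c 0 i).

(** Induction on the number [l] of free coordinates, for all frozen values [c]: interpolating in the
    last free coordinate leaves its powers times functions with one free coordinate fewer. *)
Lemma polynomial_hom_part f k : (forall z, U z -> differentiable f z) ->
  polynomial_fun (hom_part f k).
Proof.
move=> fd.
(* Degree [k] can be interpolated at 2^k nodes, so q = k serves. *)
have kq : (k < 2 ^ k)%N by rewrite ltn_expl.
suff pmix l c : (l <= n)%N -> polynomial_fun (fun z => hom_part f k (mix l z c)).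
  rewrite (_ : hom_part f k = fun z => hom_part f k (mix n z 0)); first exact: pmix.
  by apply/funext => z; congr hom_part; apply/rowP => i; rewrite mxE ltn_ord.
elim: l c => [|l IH] c ln.
  rewrite (_ : (fun z => _) = fun=> hom_part f k c); first exact: polynomial_fun_cst.
  by apply/funext => z; congr hom_part; apply/rowP => i; rewrite mxE.
pose j := Ordinal ln.
have mixE z v : upd (mix l.+1 z c) j v = mix l z (upd c j v).
  apply/rowP => i; rewrite !mxE -val_eqE /=.
  by case: (ltngtP i l) => [il|il|//]; rewrite ltnS ?(ltnW il) // leqNgt il.
rewrite (_ : (fun z => _) = fun z => \sum_(m < k.+1) z 0 j ^+ m *
    avg k (fun v => v^-1 ^+ m * hom_part f k (mix l z (upd c j v)))).
  apply: polynomial_fun_sum => m; apply: polynomial_fun_mulX; apply: polynomial_funZ.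
  apply: polynomial_fun_sum => i; apply: polynomial_funZ; apply: IH; exact: ltnW.
apply/funext => z; rewrite (hom_part_interp _ j fd kq).
apply: eq_bigr => m _; rewrite [mix _ _ _ 0 j]mxE ltnSn.
apply: (congr1 (fun x => z 0 j ^+ m * x)).
apply: eq_avg => v _.
apply: (congr1 (fun x => v^-1 ^+ m * x)).
apply: (congr1 (hom_part f k)).
exact: mixE.
Qed.

End Homogeneous.

(** * Convergence and measurability of the approximants *)

Lemma hom_part_dom (R : realType) (n : nat) (U : set 'rV[R[i]]_n)
    (f : 'rV[R[i]]_n -> R[i]) k z :
  open U -> balanced U -> holomorphic_on U f -> U z ->
  hom_part U f k z = coef (fun u => f (u *: z)) k.
Proof.
move=> oU bU fd Uz; have U0 : U 0.
  by rewrite -(scale0r z); apply: bU; rewrite // normr0 ler01.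
rewrite (@hom_partE _ _ _ oU bU U0 f k z 1) ?scale1r ?oner_neq0 //.
by rewrite invr1 expr1n mul1r.
Qed.

(** [cesaro_dist] is used for u -> f(u z) at u = 1; compactness of circle times [K] makes [S] and
    [d] independent of [z], so its explicit rate is uniform on [K]. *)
Lemma cesaro_hom_part_cvg (R : realType) (n : nat) (U : set 'rV[R[i]]_n)
    (f : 'rV[R[i]]_n -> R[i]) :
  open U -> balanced U -> holomorphic_on U f ->
  cvg_locally_uniformly U
    (fun m z => cesaro_sum m.+1 (fun k => hom_part U f k z)) f.
Proof.
move=> oU bU fd K cK KU e e0.
have [r r0 ->] : exists2 r : R, 0 < r & e = r%:C%C.
  have eE : e = (complex.Re e)%:C%C by rewrite RRe_real // gtr0_real.
  by exists (complex.Re e); rewrite // -ltcR -eE.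
have r20 : 0 < r / 2 by lra.
pose F (p : R[i] * 'rV[R[i]]_n) := f (p.1 *: p.2).
have cTK := compact_setX (@compact_circle R) cK.
have cont p : ([set z : R[i] | normc z = 1] `*` K) p -> {for p, continuous F}.
  case: p => u z [/= u1 Kz]; apply: continuous_scale_pair; apply: fd.
  by apply: (balancedZ bU (KU _ Kz)); rewrite u1.
have [S S0 hS] := compact_normc_bounded cTK cont.
have [d d0 hd] := compact_unif_continuous cTK cont r20.
have w0 : 0 < d ^+ 2 * (r / 2) by rewrite mulr_gt0 ?exprn_gt0.
pose x := 8 * S / (d ^+ 2 * (r / 2)).
have xM : x < (Num.bound x)%:R.
  by apply: archi_boundP; rewrite divr_ge0 ?mulr_ge0 // ltW.
exists (Num.bound x) => m Mm z Kz; rewrite normrC ltcR.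
have Uz := KU _ Kz.
have -> : cesaro_sum m.+1 (fun k => hom_part U f k z) =
    cesaro_sum m.+1 (coef (fun u => f (u *: z))).
  congr (_ * _); apply: eq_bigr => l _; apply: eq_bigr => k _.
  exact: hom_part_dom.
have hm : 8 * S / (m.+1%:R * d ^+ 2) < r / 2.
  have xm : x < m.+1%:R by rewrite (lt_le_trans xM) // ler_nat ltnW.
  rewrite ltr_pdivrMr ?mulr_gt0 ?exprn_gt0 // mulrCA.
  by rewrite [r / 2 * _]mulrC -ltr_pdivrMr.
have := @cesaro_dist R (fun u => f (u *: z)) S d (r / 2) m.+1 _ (ltn0Sn _) d0 (ltW r20) _ _.
rewrite scale1r => /(_ _ _ _)/le_lt_trans; apply; last by rewrite [ltRHS](splitr r) ltrD2l.
- by move=> u u1; apply: derivable_ray; apply: fd; exact: (balancedZ bU Uz u1).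
- by move=> u u1; exact: (hS (u, z)).
- move=> u u1 u1d; rewrite normcBC ltW //.
  have := hd (1, z) (u, z); rewrite /F /= scale1r; apply.
    by split => //=; exact: normc1E.
  by split => /=; [apply/ballCE; rewrite normcBC|apply: ballxx; rewrite ltcR].
Qed.

(** The coefficient is a limit of finite means of values of [f] at points of [U] that do not depend
    on the random parameter. *)
Lemma measurable_hom_part d (T : measurableType d) (R : realType) (n : nat)
    (U : set 'rV[R[i]]_n) (f : T -> 'rV[R[i]]_n -> R[i]) k z :
  open U -> balanced U -> U 0 -> random_holomorphic U f ->
  measurable_C (fun w => hom_part U (f w) k z).
Proof.
move=> oU bU U0 [fd fm]; have [t0 Ut] := into_domP oU U0 z.
apply: measurable_CZ.
pose G m w := avg m (fun u => f w (u *: (into_dom U z *: z)) * u^-1 ^+ k).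
apply: (@measurable_C_cvg _ _ _ G) => [m|w].
  apply: measurable_CZ; apply: measurable_C_sum => j.
  rewrite (_ : (fun w => _) = fun w => (zeta R m ^+ j)^-1 ^+ k *
    f w (zeta R m ^+ j *: (into_dom U z *: z))).
    apply: measurable_CZ; apply: fm; apply: (balancedZ bU Ut).
    by rewrite normc_zetaX.
  by apply/funext => w; rewrite mulrC.
apply: coef_cvg => u u1; apply: derivable_ray; apply: fd.
by apply: (balancedZ bU Ut); rewrite u1.
Qed.

Unset Implicit Arguments.

Theorem theorem4p5 (d : measure_display) (Omega : measurableType d)
    (R : realType) (n : nat) (U : set 'rV[R[i]]_n)
    (f : Omega -> 'rV[R[i]]_n -> R[i]) :
  open U -> balanced U -> random_holomorphic U f ->
  exists p : nat -> Omega -> 'rV[R[i]]_n -> R[i],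
    (forall m, random_polynomial (p m)) /\
    (forall w, cvg_locally_uniformly U (fun m => p m w) (f w)).
Proof.
move=> oU bU fh; have [fd _] := fh.
(* A balanced set missing 0 is empty, since scaling by 0 sends any of its points to 0; zero
   polynomials then suffice. *)
have [U0|nU0] := pselect (U 0); last first.
  exists (fun _ _ _ => 0); split=> [m|w K _ KU e _].
    by split=> *; [exact: polynomial_fun_cst|exact: measurable_C_cst].
  exists 0%N => m _ z Kz; exfalso; apply: nU0.
  by rewrite -(scale0r z); apply: bU (KU _ Kz) _; rewrite normr0 ler01.
(* Starting at [m.+1] avoids the mean of an empty family of partial sums. *)
exists (fun m w z => cesaro_sum m.+1 (fun k => hom_part U (f w) k z)).
split=> [m|w]; last exact: cesaro_hom_part_cvg.
split=> [w|z].
  apply: polynomial_funZ; apply: polynomial_fun_sum => l; apply: polynomial_fun_sum => k.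
  exact: (polynomial_hom_part oU bU U0 (l - k)%N (fd w)).
apply: measurable_CZ; apply: measurable_C_sum => l; apply: measurable_C_sum => k.
exact: measurable_hom_part.
Qed.
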